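(* Let $\mathbb{K}$ be an algebraically closed field of characteristic $0$ and let $\mathfrak{l}$ be a Lie algebra or a Lie superalgebra over $\mathbb{K}$ (in the superalgebra case, with center $C(\mathfrak{l})\subseteq \mathfrak{l}_{\bar 0}$). Let $\mathfrak{g}=\mathfrak{l}\otimes\mathbb{K}[x]$ (with $\mathbb{I}=\mathbb{N}$) or $\mathfrak{g}=\mathfrak{l}\otimes\mathbb{K}[x,x^{-1}]$ (with $\mathbb{I}=\mathbb{Z}$) be the current or loop (super)algebra of $\mathfrak{l}$. Let $\{e_i\mid i\in I\}$ be a basis of $\mathfrak{l}$ (homogeneous in the superalgebra case) such that $\{e_j\mid j\in J\}$, $J\subseteq I$, is a basis of $C(\mathfrak{l})$, and put $e_{ir}=e_i\otimes x^r$ for $i\in I$, $r\in\mathbb{I}$. Then the center $Z(\mathfrak{g})$ of $U(\mathfrak{g})$ is equal to $\mathbb{K}[e_{jr}\mid j\in J, r\in\mathbb{I}]$, the subalgebra generated by the $e_{jr}$ with $j\in J$, $r\in\mathbb{I}$. In particular, if $C(\mathfrak{l})\neq\{0\}$, then $Z(\mathfrak{g})$ is freely generated by $\{e_{jr}\mid j\in J, r\in\mathbb{I}\}$.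
   Context: The current (super)algebra $\mathfrak{l}[x]=\mathfrak{l}\otimes\mathbb{K}[x]$ and the loop (super)algebra $\mathfrak{l}(x)=\mathfrak{l}\otimes\mathbb{K}[x,x^{-1}]$ have bracket $[e\otimes x^r,f\otimes x^s]=[e,f]\otimes x^{r+s}$ for $e,f\in\mathfrak{l}$ and $r,s\in\mathbb{N}$ (resp. $r,s\in\mathbb{Z}$), where $\mathbb{N}$ includes $0$; in the super case the $\mathbb{Z}_2$-grading is $|e\otimes x^r|=|e|$. $C(\mathfrak{l})=\{z\in\mathfrak{l}\mid [z,y]=0\ \forall y\in\mathfrak{l}\}$ is the center of $\mathfrak{l}$. $U(\mathfrak{g})$ is the universal enveloping (super)algebra, and its center is $Z(\mathfrak{g})=\{z\in U(\mathfrak{g})\mid [z,u]=0\ \forall u\in U(\mathfrak{g})\}$, where $[z,u]=zu-uz$ in the Lie algebra case and $[z,u]=zu-(-1)^{|z||u|}uz$ (for homogeneous elements, extended bilinearly) in the Lie superalgebra case. ''Freely generated'' means that the given elements generate the algebra as a commutative $\mathbb{K}$-algebra and are algebraically independent. If $J=\varnothing$, then $\mathbb{K}[e_{jr}\mid j\in J, r\in\mathbb{I}]=\mathbb{K}$. *)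

(* Defs.v *)
From HB Require Import structures.
From mathcomp Require Import all_boot all_order all_algebra.
From mathcomp Require Import finmap boolp classical_sets.
From mathcomp Require Import monalg.

Set Implicit Arguments.
Unset Strict Implicit.
Unset Printing Implicit Defensive.

Import GRing.Theory.

Local Open Scope ring_scope.
Local Open Scope quotient_scope.

HB.mixin Record hasBracket (K : fieldType) L of GRing.Lmodule K L := {
  br : L -> L -> L;
  br_linearl : forall z, linear (br^~ z);
  br_linearr : forall z, linear (br z)
}.

#[short(type="bracketAlgType")]
HB.structure Definition BracketAlg (K : fieldType) :=
  { L of GRing.Lmodule K L & hasBracket K L }.

HB.mixin Record Bracket_isLie (K : fieldType) L of BracketAlg K L := {
  lie_alt : forall x : L, br x x = 0;
  lie_jacobi : forall x y z : L,
    br x (br y z) + br y (br z x) + br z (br x y) = 0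
}.

#[short(type="lieAlgType")]
HB.structure Definition LieAlg (K : fieldType) :=
  { L of BracketAlg K L & Bracket_isLie K L }.

(* A decomposition V = V_0 (+) V_1 is given by its two projections; the parity
   0 is encoded by false, the parity 1 by true. *)
HB.mixin Record isZ2Graded (K : fieldType) V of GRing.Lmodule K V := {
  gcomp : bool -> V -> V;
  gcomp_linear : forall a, linear (gcomp a);
  gcompK : forall a b x, gcomp a (gcomp b x) = if a == b then gcomp b x else 0;
  gcomp_sum : forall x, gcomp false x + gcomp true x = x
}.

#[short(type="superModType")]
HB.structure Definition SuperMod (K : fieldType) :=
  { V of GRing.Lmodule K V & isZ2Graded K V }.

Definition homogeneous (K : fieldType) (V : superModType K) (a : bool) : set V :=
  [set x | gcomp a x = x]%classic.

HB.mixin Record Bracket_isLieSuper (K : fieldType) L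
    of BracketAlg K L & SuperMod K L := {
  br_homog : forall a b (x y : L),
    homogeneous a x -> homogeneous b y -> homogeneous (a (+) b) (br x y);
  br_superC : forall a b (x y : L), homogeneous a x -> homogeneous b y ->
    br x y = - ((-1) ^+ (a && b) *: br y x);
  br_superJacobi : forall a b (x y z : L), homogeneous a x -> homogeneous b y ->
    br x (br y z) = br (br x y) z + (-1) ^+ (a && b) *: br y (br x z)
}.

(* Over a field of characteristic other than 2 and 3 these are the usual Lie
   superalgebras. *)
#[short(type="lieSuperAlgType")]
HB.structure Definition LieSuperAlg (K : fieldType) :=
  { L of BracketAlg K L & SuperMod K L & Bracket_isLieSuper K L }.

HB.mixin Record Algebra_isSuper (K : fieldType) A
    of GRing.Algebra K A & SuperMod K A := {
  homogeneousM : forall a b (x y : A),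
    homogeneous a x -> homogeneous b y -> homogeneous (a (+) b) (x * y)
}.

#[short(type="superAlgType")]
HB.structure Definition SuperAlg (K : fieldType) :=
  { A of GRing.Algebra K A & SuperMod K A & Algebra_isSuper K A }.

Section Brackets.
Variables (K : fieldType) (L : bracketAlgType K).

Lemma brDl (x y z : L) : br (x + y) z = br x z + br y z.
Proof. by have := br_linearl z 1 x y; rewrite !scale1r. Qed.
Lemma brDr (x y z : L) : br z (x + y) = br z x + br z y.
Proof. by have := br_linearr z 1 x y; rewrite !scale1r. Qed.
Lemma br0l (z : L) : br 0 z = 0.
Proof. by have /eqP := brDl 0 0 z; rewrite addr0 -subr_eq0 opprD addNKr oppr_eq0 => /eqP. Qed.
Lemma br0r (z : L) : br z 0 = 0.
Proof. by have /eqP := brDr 0 0 z; rewrite addr0 -subr_eq0 opprD addNKr oppr_eq0 => /eqP. Qed.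
Lemma brZl a (x z : L) : br (a *: x) z = a *: br x z.
Proof. by have := br_linearl z a x 0; rewrite !addr0 br0l addr0. Qed.
Lemma brZr a (x z : L) : br z (a *: x) = a *: br z x.
Proof. by have := br_linearr z a x 0; rewrite !addr0 br0r addr0. Qed.

Definition jac (x y z : L) : L := br x (br y z) + br y (br z x) + br z (br x y).
Lemma jac_cycle x y z : jac x y z = jac y z x.
Proof. by rewrite /jac -addrA addrC. Qed.
Lemma jacD x x' y z : jac (x + x') y z = jac x y z + jac x' y z.
Proof. by rewrite /jac !(brDl, brDr) [X in X + _ = _]addrACA [LHS]addrACA. Qed.
Lemma jac0 y z : jac 0 y z = 0.
Proof. by rewrite /jac !(br0l, br0r) !addr0. Qed.

Definition superjac (c : K) (x y z : L) : L :=
  br x (br y z) - br (br x y) z - c *: br y (br x z).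
Lemma superjacDl c x x' y z :
  superjac c (x + x') y z = superjac c x y z + superjac c x' y z.
Proof.
rewrite /superjac !(brDl, brDr) scalerDr !opprD.
by rewrite [X in X + _ = _]addrACA [LHS]addrACA.
Qed.
Lemma superjacDm c x y y' z :
  superjac c x (y + y') z = superjac c x y z + superjac c x y' z.
Proof.
rewrite /superjac !(brDl, brDr) scalerDr !opprD.
by rewrite [X in X + _ = _]addrACA [LHS]addrACA.
Qed.
Lemma superjacDr c x y z z' :
  superjac c x y (z + z') = superjac c x y z + superjac c x y z'.
Proof.
rewrite /superjac !(brDl, brDr) scalerDr !opprD.
by rewrite [X in X + _ = _]addrACA [LHS]addrACA.
Qed.
Lemma superjac0l c y z : superjac c 0 y z = 0.
Proof. by rewrite /superjac !(br0l, br0r) scaler0 !subr0. Qed.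
Lemma superjac0m c x z : superjac c x 0 z = 0.
Proof. by rewrite /superjac !(br0l, br0r) scaler0 !subr0. Qed.
Lemma superjac0r c x y : superjac c x y 0 = 0.
Proof. by rewrite /superjac !(br0l, br0r) scaler0 !subr0. Qed.

Definition lie_center : set L := [set z | forall y, br z y = 0]%classic.
End Brackets.
Arguments lie_center {K} L _.

Section SuperModTheory.
Variables (K : fieldType) (V : superModType K).

Lemma gcompD a (x y : V) : gcomp a (x + y) = gcomp a x + gcomp a y.
Proof. by have := gcomp_linear a 1 x y; rewrite !scale1r. Qed.
Lemma gcomp0 a : gcomp a (0 : V) = 0.
Proof. by have /eqP := gcompD a 0 0; rewrite addr0 -subr_eq0 opprD addNKr oppr_eq0 => /eqP. Qed.
Lemma gcompZ a c (x : V) : gcomp a (c *: x) = c *: gcomp a x.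
Proof. by have := gcomp_linear a c x 0; rewrite !addr0 gcomp0 addr0. Qed.
Lemma homog_gcomp a (x : V) : homogeneous a (gcomp a x).
Proof. by rewrite /homogeneous /= gcompK eqxx. Qed.
Lemma homog_gcompE a b (x : V) : homogeneous b x -> gcomp a x = if a == b then x else 0.
Proof. by rewrite /homogeneous /= => <-; rewrite gcompK. Qed.
Lemma homog0 a : homogeneous a (0 : V).
Proof. exact: gcomp0. Qed.
End SuperModTheory.

(* l (x) K[x] for I = nat and l (x) K[x, x^-1] for I = int, seen as the
   finitely supported families of elements of l indexed by the exponents:
   << u *g r >> is u (x) x^r. *)
Definition mapalg (K : fieldType) (l : lmodType K) (I : nmodType) : Type :=
  {malg l[I]}.

Definition tens (K : fieldType) (l : lmodType K) (I : nmodType) (u : l) (r : I) :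
  mapalg l I := << u *g r >>.

Section MapLmod.
Variables (K : fieldType) (l : lmodType K) (I : nmodType).
Local Notation M := (mapalg l I).

HB.instance Definition _ := GRing.Zmodule.copy M {malg l[I]}.

Definition map_scale (c : K) (f : M) : M :=
  [malg r in msupp (f : {malg l[I]}) => c *: (f : {malg l[I]})@_r].

Lemma map_scaleE c f r : (map_scale c f : {malg l[I]})@_r = c *: (f : {malg l[I]})@_r.
Proof. by rewrite mcoeffE; case: msuppP; rewrite ?scaler0. Qed.

Lemma map_scalerA a b f : map_scale a (map_scale b f) = map_scale (a * b) f.
Proof. by apply/malgP => r; rewrite !map_scaleE scalerA. Qed.
Lemma map_scale1r : left_id 1 map_scale.
Proof. by move=> f; apply/malgP => r; rewrite !map_scaleE scale1r. Qed.
Lemma map_scalerDr : right_distributive map_scale +%R.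
Proof. by move=> c f g; apply/malgP => r; rewrite mcoeffD !map_scaleE mcoeffD scalerDr. Qed.
Lemma map_scalerDl f : {morph map_scale^~ f : a b / a + b}.
Proof. by move=> a b; apply/malgP => r; rewrite mcoeffD !map_scaleE scalerDl. Qed.

HB.instance Definition _ := GRing.Zmodule_isLmodule.Build K M
  map_scalerA map_scale1r map_scalerDr map_scalerDl.

Lemma mapalg_coefZ (c : K) (f : M) r :
  ((c *: f : M) : {malg l[I]})@_r = c *: (f : {malg l[I]})@_r.
Proof. exact: map_scaleE. Qed.

Lemma tens_linear r : linear (fun u : l => tens u r : M).
Proof.
move=> c u v; apply/malgP => s; rewrite mcoeffD mapalg_coefZ !mcoeffU.
by rewrite mulrnDl scalerMnr.
Qed.
Lemma tensD u v r : (tens (u + v) r : M) = tens u r + tens v r.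
Proof. by have := tens_linear r 1 u v; rewrite !scale1r. Qed.
Lemma tens0 r : (tens 0 r : M) = 0.
Proof. exact: monalgU0. Qed.
Lemma tensZ c u r : (tens (c *: u) r : M) = c *: tens u r.
Proof. by have := tens_linear r c u 0; rewrite !addr0 tens0 addr0. Qed.
Lemma tensN u r : (tens (- u) r : M) = - tens u r.
Proof. exact: monalgUN. Qed.

Lemma mapalg_ind (P : M -> Prop) : P 0 -> (forall f g, P f -> P g -> P (f + g)) ->
  (forall u r, P (tens u r)) -> forall f, P f.
Proof.
move=> P0 PD PU f; rewrite [f]monalgE; apply: (@big_ind M P) => // r _.
exact: PU.
Qed.
End MapLmod.

Section MapBracket.
Variables (K : fieldType) (l : bracketAlgType K) (I : nmodType).
Local Notation M := (mapalg l I).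

Definition map_br (f g : M) : M :=
  \sum_(r <- msupp (f : {malg l[I]})) \sum_(s <- msupp (g : {malg l[I]}))
     tens (br (f : {malg l[I]})@_r (g : {malg l[I]})@_s) (r + s).

Lemma map_brEw (D E : {fset I}) (f g : M) :
  fsubset (msupp (f : {malg l[I]})) D -> fsubset (msupp (g : {malg l[I]})) E ->
  map_br f g = \sum_(r <- D) \sum_(s <- E)
     tens (br (f : {malg l[I]})@_r (g : {malg l[I]})@_s) (r + s).
Proof.
move=> sD sE; rewrite /map_br (big_fset_incl _ sD) => [|r _ rf] /=; last first.
  by rewrite big1 // => s _; rewrite (mcoeff_outdom rf) br0l tens0.
apply: eq_bigr => r _; apply: (big_fset_incl _ sE) => s _ sg.
by rewrite (mcoeff_outdom sg) br0r tens0.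
Qed.

Lemma map_br_linearl g : linear (map_br^~ g).
Proof.
move=> a f h.
pose D := fsetU (msupp (a *: f + h : {malg l[I]}))
  (fsetU (msupp (f : {malg l[I]})) (msupp (h : {malg l[I]}))).
have sE : fsubset (msupp (g : {malg l[I]})) (msupp (g : {malg l[I]})) by [].
rewrite !(@map_brEw D (msupp (g : {malg l[I]}))) ?fsubsetUl //; last 2 first.
- by apply: fsubset_trans (fsubsetUr _ _); apply: fsubsetUr.
- by apply: fsubset_trans (fsubsetUr _ _); apply: fsubsetUl.
rewrite scaler_sumr -big_split; apply: eq_bigr => r _ /=.
rewrite scaler_sumr -big_split; apply: eq_bigr => s _ /=.
by rewrite mcoeffD mapalg_coefZ br_linearl tens_linear.
Qed.

Lemma map_br_linearr g : linear (map_br g).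
Proof.
move=> a f h.
pose D := fsetU (msupp (a *: f + h : {malg l[I]}))
  (fsetU (msupp (f : {malg l[I]})) (msupp (h : {malg l[I]}))).
have sE : fsubset (msupp (g : {malg l[I]})) (msupp (g : {malg l[I]})) by [].
rewrite !(@map_brEw (msupp (g : {malg l[I]})) D) ?fsubsetUl //; last 2 first.
- by apply: fsubset_trans (fsubsetUr _ _); apply: fsubsetUr.
- by apply: fsubset_trans (fsubsetUr _ _); apply: fsubsetUl.
rewrite scaler_sumr -big_split; apply: eq_bigr => r _ /=.
rewrite scaler_sumr -big_split; apply: eq_bigr => s _ /=.
by rewrite mcoeffD mapalg_coefZ br_linearr tens_linear.
Qed.

HB.instance Definition _ :=
  hasBracket.Build K M map_br_linearl map_br_linearr.

Lemma map_brU (u v : l) (r s : I) :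
  br (tens u r : M) (tens v s) = tens (br u v) (r + s).
Proof.
rewrite [LHS](@map_brEw [fset r]%fset [fset s]%fset) ?msuppU_le //.
by rewrite !big_seq_fset1 !mcoeffUU.
Qed.
End MapBracket.

Section MapLie.
Variables (K : fieldType) (l : lieAlgType K) (I : nmodType).
Local Notation M := (mapalg l I).

Let lieN (x y : l) : br x y = - br y x.
Proof.
have := lie_alt (x + y); rewrite brDl !brDr !lie_alt add0r addr0.
by move/eqP; rewrite addr_eq0 => /eqP.
Qed.

Let map_brC (f g : M) : br f g = - br g f.
Proof.
elim/mapalg_ind: f => [|f h If Ih|u r]; first by rewrite br0l br0r oppr0.
  by rewrite brDl brDr opprD If Ih.
elim/mapalg_ind: g => [|f h If Ih|v s]; first by rewrite br0l br0r oppr0.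
  by rewrite brDl brDr opprD If Ih.
by rewrite !map_brU lieN tensN addrC.
Qed.

Lemma map_lie_alt (f : M) : br f f = 0.
Proof.
elim/mapalg_ind: f => [|f h If Ih|u r]; first exact: br0l.
  by rewrite brDl !brDr If Ih add0r addr0 map_brC addNr.
by rewrite map_brU lie_alt tens0.
Qed.

Lemma map_lie_jacobi (f g h : M) :
  br f (br g h) + br g (br h f) + br h (br f g) = 0.
Proof.
change (jac f g h = 0).
elim/mapalg_ind: f => [|f f' If If'|u r]; first exact: jac0.
  by rewrite jacD If If' addr0.
rewrite jac_cycle; elim/mapalg_ind: g => [|f f' If If'|v s]; first exact: jac0.
  by rewrite jacD If If' addr0.
rewrite jac_cycle; elim/mapalg_ind: h => [|f f' If If'|w t]; first exact: jac0.
  by rewrite jacD If If' addr0.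
rewrite jac_cycle /jac !map_brU.
have -> : s + (t + r) = r + (s + t) by rewrite addrA addrC.
have -> : t + (r + s) = r + (s + t) by rewrite addrCA (addrC t).
by rewrite -!tensD lie_jacobi tens0.
Qed.

HB.instance Definition _ :=
  Bracket_isLie.Build K M map_lie_alt map_lie_jacobi.
End MapLie.

Section MapSuper.
Variables (K : fieldType) (l : superModType K) (I : nmodType).
Local Notation M := (mapalg l I).

Definition map_gcomp (a : bool) (f : M) : M :=
  [malg r in msupp (f : {malg l[I]}) => gcomp a (f : {malg l[I]})@_r].

Lemma map_gcompE a f r :
  (map_gcomp a f : {malg l[I]})@_r = gcomp a (f : {malg l[I]})@_r.
Proof. by rewrite mcoeffE; case: msuppP; rewrite ?gcomp0. Qed.

Lemma map_gcomp_linear a : linear (map_gcomp a).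
Proof.
move=> c f g; apply/malgP => r.
by rewrite mcoeffD mapalg_coefZ !map_gcompE mcoeffD mapalg_coefZ gcomp_linear.
Qed.
Lemma map_gcompK a b f :
  map_gcomp a (map_gcomp b f) = if a == b then map_gcomp b f else 0.
Proof.
apply/malgP => r; rewrite !map_gcompE gcompK.
by case: eqP => _; rewrite ?map_gcompE ?mcoeff0.
Qed.
Lemma map_gcomp_sum f : map_gcomp false f + map_gcomp true f = f.
Proof. by apply/malgP => r; rewrite mcoeffD !map_gcompE gcomp_sum. Qed.

HB.instance Definition _ :=
  isZ2Graded.Build K M map_gcomp_linear map_gcompK map_gcomp_sum.

Lemma homog_coef a (f : M) r : homogeneous a f -> homogeneous a (f : {malg l[I]})@_r.
Proof. by rewrite /homogeneous /= => fE; rewrite -[RHS](congr1 (mcoeff r) fE) map_gcompE. Qed.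

Lemma homog_tens a (u : l) r : homogeneous a u -> homogeneous a (tens u r : M).
Proof.
rewrite /homogeneous /= => uE; apply/malgP => s.
by rewrite map_gcompE mcoeffU; case: eqP; rewrite ?mulr1n ?mulr0n ?gcomp0.
Qed.

Lemma homog_mapalg_ind a (P : M -> Prop) : P 0 ->
  (forall f g, P f -> P g -> P (f + g)) ->
  (forall u r, homogeneous a u -> P (tens u r)) -> forall f, homogeneous a f -> P f.
Proof.
move=> P0 PD PU f fa; rewrite [f]monalgE; apply: (@big_ind M P) => // r _.
by apply/PU/homog_coef.
Qed.
End MapSuper.

Section MapLieSuper.
Variables (K : fieldType) (l : lieSuperAlgType K) (I : nmodType).
Local Notation M := (mapalg l I).

Lemma map_br_homog a b (f g : M) :
  homogeneous a f -> homogeneous b g -> homogeneous (a (+) b) (br f g).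
Proof.
have hD (f' g' : M) : homogeneous (a (+) b) f' -> homogeneous (a (+) b) g' ->
    homogeneous (a (+) b) (f' + g').
  by rewrite /homogeneous /= => e e'; rewrite gcompD e e'.
move=> fa; move: f fa g; apply: homog_mapalg_ind => [g _|f h If Ih g gb|u r ua].
- by rewrite br0l; exact: homog0.
- by rewrite brDl; apply: hD; [exact: If|exact: Ih].
apply: homog_mapalg_ind => [|f h If Ih|v s vb].
- by rewrite br0r; exact: homog0.
- by rewrite brDr; apply: hD.
by rewrite map_brU; apply/homog_tens/br_homog.
Qed.

Lemma map_br_superC a b (f g : M) : homogeneous a f -> homogeneous b g ->
  br f g = - ((-1) ^+ (a && b) *: br g f).
Proof.
move=> fa; move: f fa g; apply: homog_mapalg_ind => [g _|f h If Ih g gb|u r ua].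
- by rewrite br0l br0r scaler0 oppr0.
- by rewrite brDl brDr scalerDr opprD If // Ih.
apply: homog_mapalg_ind => [|f h If Ih|v s vb].
- by rewrite br0l br0r scaler0 oppr0.
- by rewrite brDl brDr scalerDr opprD If // Ih.
by rewrite !map_brU (br_superC _ _ _ _ ua vb) tensN tensZ [s + r]addrC.
Qed.

Lemma map_br_superJacobi a b (f g h : M) : homogeneous a f -> homogeneous b g ->
  br f (br g h) = br (br f g) h + (-1) ^+ (a && b) *: br g (br f h).
Proof.
move=> fa gb.
have: superjac ((-1) ^+ (a && b)) f g h = 0; last first.
  by move/eqP; rewrite subr_eq0 subr_eq addrC => /eqP.
move: f fa; apply: homog_mapalg_ind => [|f f' If If'|u r ua].
- exact: superjac0l.
- by rewrite superjacDl If If' addr0.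
move: g gb; apply: homog_mapalg_ind => [|f f' If If'|v s vb].
- exact: superjac0m.
- by rewrite superjacDm If If' addr0.
elim/mapalg_ind: h => [|f f' If If'|w t]; first exact: superjac0r.
  by rewrite superjacDr If If' addr0.
rewrite /superjac !map_brU (br_superJacobi _ _ _ _ w ua vb) tensD tensZ.
have -> : s + (r + t) = r + (s + t) by rewrite addrCA.
by rewrite -[r + s + t]addrA; apply/eqP; rewrite subr_eq0 subr_eq; apply/eqP/addrC.
Qed.

HB.instance Definition _ := Bracket_isLieSuper.Build K M
  map_br_homog map_br_superC map_br_superJacobi.
End MapLieSuper.

Variant map_kind := Current | Loop.

Definition exponents (k : map_kind) : nmodType :=
  match k with Current => nat | Loop => int end.

(* The unital associative K-algebra generated by the vector space G subject to
   the relations x y = c y x + z for all (x, y, c, z) in rel, that is, the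
   quotient of the tensor algebra T(G) by the two-sided ideal generated by the
   elements x y - c y x - z. *)
Section PresentedAlgebra.
Variables (K : fieldType) (G : lmodType K) (rel : G -> G -> K -> G -> Prop).

Inductive aterm : Type :=
| AConst of K
| AGen of G
| AAdd of aterm & aterm
| AMul of aterm & aterm.

HB.instance Definition _ := gen_eqMixin aterm.
HB.instance Definition _ := gen_choiceMixin aterm.

Inductive acong : aterm -> aterm -> Prop :=
| acong_refl t : acong t t
| acong_sym t u : acong t u -> acong u t
| acong_trans t u v : acong t u -> acong u v -> acong t v
| acong_add t t' u u' : acong t t' -> acong u u' -> acong (AAdd t u) (AAdd t' u')
| acong_mul t t' u u' : acong t t' -> acong u u' -> acong (AMul t u) (AMul t' u')
| acong_addA t u v : acong (AAdd t (AAdd u v)) (AAdd (AAdd t u) v)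
| acong_addC t u : acong (AAdd t u) (AAdd u t)
| acong_add0 t : acong (AAdd (AConst 0) t) t
| acong_mulA t u v : acong (AMul t (AMul u v)) (AMul (AMul t u) v)
| acong_mul1 t : acong (AMul (AConst 1) t) t
| acong_mul0 t : acong (AMul (AConst 0) t) (AConst 0)
| acong_mulDl t u v : acong (AMul (AAdd t u) v) (AAdd (AMul t v) (AMul u v))
| acong_mulDr t u v : acong (AMul t (AAdd u v)) (AAdd (AMul t u) (AMul t v))
| acong_constD c d : acong (AConst (c + d)) (AAdd (AConst c) (AConst d))
| acong_constM c d : acong (AConst (c * d)) (AMul (AConst c) (AConst d))
| acong_constC c t : acong (AMul (AConst c) t) (AMul t (AConst c))
| acong_gen c x y :
    acong (AGen (c *: x + y)) (AAdd (AMul (AConst c) (AGen x)) (AGen y))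
| acong_rel x y c z : rel x y c z ->
    acong (AMul (AGen x) (AGen y))
          (AAdd (AMul (AConst c) (AMul (AGen y) (AGen x))) (AGen z)).

Definition acongb (t u : aterm) : bool := `[< acong t u >].

Lemma acongb_refl : reflexive acongb.
Proof. by move=> t; apply/asboolP/acong_refl. Qed.
Lemma acongb_sym : symmetric acongb.
Proof. by move=> t u; apply/asboolP/asboolP; apply: acong_sym. Qed.
Lemma acongb_trans : transitive acongb.
Proof.
by move=> u t v /asboolP tu /asboolP uv; apply/asboolP; apply: acong_trans uv.
Qed.

Canonical acong_equiv := EquivRel acongb acongb_refl acongb_sym acongb_trans.

Definition palg : Type := {eq_quot acong_equiv}.

HB.instance Definition _ := Choice.copy palg {eq_quot acong_equiv}.

Definition ppi (t : aterm) : palg := \pi_{eq_quot acong_equiv} t.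
Definition prep (p : palg) : aterm := repr (p : {eq_quot acong_equiv}).

Lemma ppiP t u : ppi t = ppi u <-> acong t u.
Proof.
split=> [e|tu]; first by apply/asboolP/(@eqmodP _ acong_equiv).
by apply/(@eqmodP _ acong_equiv)/asboolP.
Qed.
Lemma prepK p : ppi (prep p) = p.
Proof. by rewrite /ppi /prep reprK. Qed.
Lemma prep_ppi t : acong (prep (ppi t)) t.
Proof. by apply/ppiP; rewrite prepK. Qed.

Definition padd p q := ppi (AAdd (prep p) (prep q)).
Definition pmul p q := ppi (AMul (prep p) (prep q)).
Definition popp p := ppi (AMul (AConst (- 1)) (prep p)).
Definition pscale c p := ppi (AMul (AConst c) (prep p)).
Definition pzero := ppi (AConst 0).
Definition pone := ppi (AConst 1).

Lemma paddE t u : padd (ppi t) (ppi u) = ppi (AAdd t u).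
Proof. by apply/ppiP; apply: acong_add; apply: prep_ppi. Qed.
Lemma pmulE t u : pmul (ppi t) (ppi u) = ppi (AMul t u).
Proof. by apply/ppiP; apply: acong_mul; apply: prep_ppi. Qed.
Lemma pscaleE c t : pscale c (ppi t) = ppi (AMul (AConst c) t).
Proof. by apply/ppiP/acong_mul/prep_ppi/acong_refl. Qed.

Lemma paddA : associative padd.
Proof.
move=> p q s; rewrite -[p]prepK -[q]prepK -[s]prepK !paddE.
exact/ppiP/acong_addA.
Qed.
Lemma paddC : commutative padd.
Proof. by move=> p q; apply/ppiP/acong_addC. Qed.
Lemma padd0 : left_id pzero padd.
Proof. by move=> p; rewrite -[p]prepK paddE; apply/ppiP/acong_add0. Qed.
Lemma pmulA : associative pmul.
Proof.
move=> p q s; rewrite -[p]prepK -[q]prepK -[s]prepK !pmulE.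
exact/ppiP/acong_mulA.
Qed.
Lemma pmul1 : left_id pone pmul.
Proof. by move=> p; rewrite -[p]prepK pmulE; apply/ppiP/acong_mul1. Qed.
Lemma pmulr1 : right_id pone pmul.
Proof.
move=> p; rewrite -[p]prepK pmulE; apply/ppiP.
exact: acong_trans (acong_sym (acong_constC _ _)) (acong_mul1 _).
Qed.
Lemma pmulDl : left_distributive pmul padd.
Proof.
move=> p q s; rewrite -[p]prepK -[q]prepK -[s]prepK !(paddE, pmulE).
exact/ppiP/acong_mulDl.
Qed.
Lemma pmulDr : right_distributive pmul padd.
Proof.
move=> p q s; rewrite -[p]prepK -[q]prepK -[s]prepK !(paddE, pmulE).
exact/ppiP/acong_mulDr.
Qed.
Lemma pscaleMl c p : pscale c p = pmul (ppi (AConst c)) p.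
Proof. by rewrite -{2}[p]prepK pmulE. Qed.
Lemma pconstD c d : ppi (AConst (c + d)) = padd (ppi (AConst c)) (ppi (AConst d)).
Proof. by rewrite paddE; apply/ppiP/acong_constD. Qed.

Lemma paddN : left_inverse pzero popp padd.
Proof.
move=> p; rewrite /popp -/(pscale _ _) pscaleMl -{2}[p]pmul1 -pmulDl -pconstD addNr.
by rewrite -[p]prepK pmulE; apply/ppiP/acong_mul0.
Qed.

Fixpoint aug (t : aterm) : K :=
  match t with
  | AConst c => c
  | AGen _ => 0
  | AAdd t u => aug t + aug u
  | AMul t u => aug t * aug u
  end.

Lemma aug_cong t u : acong t u -> aug t = aug u.
Proof.
elim=> //= {t u}; try by move=> *; congruence.
- by move=> *; rewrite addrA.
- by move=> *; rewrite addrC.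
- by move=> *; rewrite add0r.
- by move=> *; rewrite mulrA.
- by move=> *; rewrite mul1r.
- by move=> *; rewrite mul0r.
- by move=> *; rewrite mulrDl.
- by move=> *; rewrite mulrDr.
- by move=> *; rewrite mulrC.
- by move=> *; rewrite mulr0 addr0.
- by move=> *; rewrite !mulr0 addr0.
Qed.

Lemma pone_neq0 : pone != pzero.
Proof. by apply/eqP => /ppiP/aug_cong/eqP; rewrite /= oner_eq0. Qed.

HB.instance Definition _ := GRing.isNzRing.Build palg
  paddA paddC padd0 paddN pmulA pmul1 pmulr1 pmulDl pmulDr pone_neq0.

Lemma ppiD t u : ppi (AAdd t u) = ppi t + ppi u. Proof. by rewrite -paddE. Qed.
Lemma ppiM t u : ppi (AMul t u) = ppi t * ppi u. Proof. by rewrite -pmulE. Qed.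

Lemma pscalerA a b p : pscale a (pscale b p) = pscale (a * b) p.
Proof.
rewrite !pscaleMl pmulA pmulE; congr pmul.
by apply/ppiP/acong_sym/acong_constM.
Qed.
Lemma pscale1r : left_id 1 pscale.
Proof. by move=> p; rewrite pscaleMl pmul1. Qed.
Lemma pscalerDr : right_distributive pscale +%R.
Proof. by move=> c p q; rewrite !pscaleMl pmulDr. Qed.
Lemma pscalerDl p : {morph pscale^~ p : a b / a + b}.
Proof. by move=> a b; rewrite !pscaleMl pconstD pmulDl. Qed.

HB.instance Definition _ := GRing.Zmodule_isLmodule.Build K palg
  pscalerA pscale1r pscalerDr pscalerDl.

Lemma pscalerAl (c : K) (p q : palg) : c *: (p * q) = (c *: p) * q.
Proof.
by have e (r : palg) : c *: r = ppi (AConst c) * r; [exact: pscaleMl|rewrite !e mulrA].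
Qed.

HB.instance Definition _ := GRing.Lmodule_isLalgebra.Build K palg pscalerAl.

Lemma pscalerAr (c : K) (p q : palg) : c *: (p * q) = p * (c *: q).
Proof.
have e (r : palg) : c *: r = ppi (AConst c) * r by exact: pscaleMl.
rewrite !e !mulrA; congr (_ * _).
by rewrite -[p]prepK -!ppiM; apply/ppiP/acong_constC.
Qed.

HB.instance Definition _ := GRing.Lalgebra_isAlgebra.Build K palg pscalerAr.

Lemma ppiC c : ppi (AConst c) = c%:A.
Proof.
have -> : c%:A = ppi (AConst c) * 1 :> palg by exact: pscaleMl.
by rewrite mulr1.
Qed.

Definition pgen (x : G) : palg := ppi (AGen x).

Lemma pgen_linear : linear pgen.
Proof.
move=> c x y; have /ppiP e := acong_gen c x y.
by rewrite /pgen e ppiD ppiM ppiC -scalerAl mul1r.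
Qed.

Lemma pgen_rel x y c z : rel x y c z ->
  pgen x * pgen y = c *: (pgen y * pgen x) + pgen z.
Proof.
move=> r; have /ppiP e := acong_rel r.
by rewrite /pgen -ppiM e ppiD !ppiM ppiC -scalerAl mul1r.
Qed.

Section Lift.
Variables (A : lalgType K) (f : G -> A).

Fixpoint aeval (t : aterm) : A :=
  match t with
  | AConst c => c%:A
  | AGen x => f x
  | AAdd t u => aeval t + aeval u
  | AMul t u => aeval t * aeval u
  end.

Definition palg_lift (p : palg) : A := aeval (prep p).
End Lift.

Section LiftTheory.
Variables (A : algType K) (f : G -> A).
Hypothesis f_linear : linear f.
Hypothesis f_rel : forall x y c z, rel x y c z ->
  f x * f y = c *: (f y * f x) + f z.

Lemma aeval_cong t u : acong t u -> aeval f t = aeval f u.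
Proof.
elim=> //= {t u}; try by move=> *; congruence.
- by move=> *; rewrite addrA.
- by move=> *; rewrite addrC.
- by move=> *; rewrite scale0r add0r.
- by move=> *; rewrite mulrA.
- by move=> *; rewrite scale1r mul1r.
- by move=> *; rewrite scale0r mul0r.
- by move=> *; rewrite mulrDl.
- by move=> *; rewrite mulrDr.
- by move=> *; rewrite scalerDl.
- by move=> *; rewrite -scalerAl mul1r scalerA.
- by move=> *; rewrite -scalerAl mul1r -scalerAr mulr1.
- by move=> *; rewrite f_linear -scalerAl mul1r.
- by move=> x y c z r; rewrite (f_rel r) -scalerAl mul1r.
Qed.

Lemma palg_lift_ppi t : palg_lift f (ppi t) = aeval f t.
Proof. exact/aeval_cong/prep_ppi. Qed.

Lemma palg_universal :
  (forall x, palg_lift f (pgen x) = f x) /\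
  linear (palg_lift f) /\ monoid_morphism (palg_lift f) /\
  (forall g : palg -> A, linear g -> monoid_morphism g ->
     (forall x, g (pgen x) = f x) -> g =1 palg_lift f).
Proof.
split=> [x|]; first exact: palg_lift_ppi.
have lD p q : palg_lift f (p + q) = palg_lift f p + palg_lift f q.
  by rewrite -[p]prepK -[q]prepK -ppiD !palg_lift_ppi.
have lM p q : palg_lift f (p * q) = palg_lift f p * palg_lift f q.
  by rewrite -[p]prepK -[q]prepK -ppiM !palg_lift_ppi.
have lC c : palg_lift f c%:A = c%:A by rewrite -ppiC palg_lift_ppi.
split; [|split; [split=> //; first by rewrite -[1]scale1r lC scale1r|]].
  move=> c p q; rewrite lD; congr (_ + _).
  by rewrite -[p]mul1r scalerAl lM lC -scalerAl !mul1r.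
move=> g gl [g1 gM] gf p; rewrite -[p]prepK palg_lift_ppi.
have gD (x y : palg) : g (x + y) = g x + g y.
  by rewrite -[x]scale1r gl !scale1r.
have g0 : g 0 = 0.
  by have /eqP := gD 0 0; rewrite addr0 -subr_eq0 opprD addNKr oppr_eq0 => /eqP.
elim: (prep p) => [c|x|t It u Iu|t It u Iu] /=; last 2 first.
- by rewrite ppiD gD It Iu.
- by rewrite ppiM gM It Iu.
- by rewrite ppiC -[c%:A]addr0 gl g1 g0 addr0.
- exact: gf.
Qed.
End LiftTheory.
End PresentedAlgebra.

Definition lie_rel (K : fieldType) (g : bracketAlgType K)
    (x y : g) (c : K) (z : g) : Prop :=
  c = 1 /\ z = br x y.

Definition lieSuper_rel (K : fieldType) (g : lieSuperAlgType K)
    (x y : g) (c : K) (z : g) : Prop :=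
  exists a b, [/\ homogeneous a x, homogeneous b y, c = (-1) ^+ (a && b) & z = br x y].

Definition ulie (K : fieldType) (g : lieAlgType K) : Type := palg (@lie_rel K g).
HB.instance Definition _ (K : fieldType) (g : lieAlgType K) :=
  GRing.Algebra.copy (ulie g) (palg (@lie_rel K g)).

Definition usuper (K : fieldType) (g : lieSuperAlgType K) : Type :=
  palg (@lieSuper_rel K g).
HB.instance Definition _ (K : fieldType) (g : lieSuperAlgType K) :=
  GRing.Algebra.copy (usuper g) (palg (@lieSuper_rel K g)).

Definition ulie_gen (K : fieldType) (g : lieAlgType K) (x : g) : ulie g :=
  pgen (@lie_rel K g) x.
Definition usuper_gen (K : fieldType) (g : lieSuperAlgType K) (x : g) : usuper g :=
  pgen (@lieSuper_rel K g) x.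

(* The Z_2-grading of the enveloping superalgebra induced by that of T(g): the
   component of degree a of a product t u is the sum over b of t_b u_(a - b). *)
Section SuperGrading.
Variables (K : fieldType) (g : lieSuperAlgType K).
Local Notation U := (usuper g).
Local Notation term := (aterm g).
Local Notation pi := (@ppi K g (@lieSuper_rel K g) : term -> U).
Local Notation "t =~ u" := (@acong K g (@lieSuper_rel K g) t u) (at level 70).

Fixpoint tcomp (a : bool) (t : term) : U :=
  match t with
  | AConst c => if a then 0 else c%:A
  | AGen x => usuper_gen (gcomp a x)
  | AAdd t u => tcomp a t + tcomp a u
  | AMul t u => tcomp false t * tcomp a u + tcomp true t * tcomp (~~ a) u
  end.

Definition ugcomp (a : bool) (p : U) : U := tcomp a (prep p).

Let gen_linear : linear (@usuper_gen K g).
Proof. exact: pgen_linear. Qed.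
Let gen0 : usuper_gen (0 : g) = 0.
Proof.
have /eqP := gen_linear 1 0 0.
by rewrite !scale1r addr0 -subr_eq0 opprD addNKr oppr_eq0 => /eqP.
Qed.

Lemma tcomp_cong t u : t =~ u -> forall a, tcomp a t = tcomp a u.
Proof.
elim=> //= {t u}.
- by move=> t u v _ e1 _ e2 a; rewrite e1 e2.
- by move=> t t' u u' _ e1 _ e2 a; rewrite e1 e2.
- by move=> t t' u u' _ e1 _ e2 a; rewrite !e1 !e2.
- by move=> *; rewrite addrA.
- by move=> *; rewrite addrC.
- by move=> t a; case: a; rewrite ?scale0r add0r.
- move=> t u v a; rewrite !mulrDr !mulrDl !mulrA negbK -!addrA.
  by congr (_ + _); rewrite [RHS]addrC addrA.
- by move=> t a; rewrite scale1r mul1r mul0r addr0.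
- by move=> t a; rewrite scale0r !mul0r addr0 if_same.
- by move=> t u v a; rewrite !mulrDl addrACA.
- by move=> t u v a; rewrite !mulrDr addrACA.
- by move=> c d a; case: a; rewrite ?addr0 // scalerDl.
- by move=> c d a; case: a; rewrite ?(mulr0, mul0r, addr0) // -scalerAl mul1r scalerA.
- move=> c t a; rewrite mul0r addr0.
  by case: a; rewrite /= !mulr0 ?(addr0, add0r) -scalerAl -scalerAr mul1r mulr1.
- by move=> c x y a; rewrite gcomp_linear gen_linear mul0r addr0 -scalerAl mul1r.
move=> x y c _ [a [b [xa yb -> ->]]] d.
have /(homog_gcompE) -> := br_homog _ _ _ _ xa yb.
rewrite !(homog_gcompE _ xa) !(homog_gcompE _ yb) mul0r addr0 -scalerAl mul1r.
have e : usuper_gen x * usuper_gen y =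
    (-1) ^+ (a && b) *: (usuper_gen y * usuper_gen x) + usuper_gen (br x y).
  by apply: pgen_rel; exists a, b.
by move: e; case: a {xa}; case: b {yb}; case: d; rewrite /= ?gen0
  ?(mulr0, mul0r, addr0, add0r, scaler0).
Qed.

Lemma ugcomp_pi a t : ugcomp a (pi t) = tcomp a t.
Proof. exact/tcomp_cong/prep_ppi. Qed.

Lemma ugcomp_linear a : linear (ugcomp a).
Proof.
move=> c p q; rewrite -[p]prepK -[q]prepK.
have -> : c *: pi (prep p) + pi (prep q) =
    pi (AAdd (AMul (AConst g c) (prep p)) (prep q)).
  by rewrite [RHS]ppiD ppiM ppiC -scalerAl mul1r.
by rewrite !ugcomp_pi /= mul0r addr0 -scalerAl mul1r.
Qed.

Let ugcompD a p q : ugcomp a (p + q) = ugcomp a p + ugcomp a q.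
Proof. by rewrite -[p]scale1r ugcomp_linear !scale1r. Qed.

Lemma ugcompM a (p q : U) : ugcomp a (p * q) =
  ugcomp false p * ugcomp a q + ugcomp true p * ugcomp (~~ a) q.
Proof.
rewrite -[p]prepK -[q]prepK.
have -> : pi (prep p) * pi (prep q) = pi (AMul (prep p) (prep q)).
  by rewrite [RHS]ppiM.
by rewrite !ugcomp_pi.
Qed.

Lemma ugcompK a b p : ugcomp a (ugcomp b p) = if a == b then ugcomp b p else 0.
Proof.
rewrite -[p]prepK ugcomp_pi.
have ug0 c : ugcomp c 0 = 0.
  have /eqP := ugcompD c 0 0.
  by rewrite addr0 -subr_eq0 opprD addNKr oppr_eq0 => /eqP.
elim: (prep p) a b => [c|x|t It u Iu|t It u Iu] a b /=.
- case: b; first by rewrite ug0 if_same.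
  by rewrite -[c%:A](ppiC (@lieSuper_rel K g)) ugcomp_pi /=; case: a; rewrite ?ppiC.
- rewrite [LHS](ugcomp_pi a (AGen _)) /= gcompK.
  by case: eqP => // _; rewrite gen0.
- by rewrite ugcompD It Iu; case: eqP; rewrite ?addr0.
rewrite ugcompD !ugcompM !It !Iu.
by case: a; case: b; rewrite /= ?(mul0r, mulr0, add0r, addr0).
Qed.

Lemma ugcomp_sum p : ugcomp false p + ugcomp true p = p.
Proof.
rewrite -[p]prepK !ugcomp_pi.
elim: (prep p) => [c|x|t It u Iu|t It u Iu] /=.
- by rewrite addr0 ppiC.
- have := gen_linear 1 (gcomp false x) (gcomp true x).
  by rewrite !scale1r gcomp_sum => <-.
- by rewrite addrACA It Iu ppiD.
rewrite ppiM -It -Iu mulrDl !mulrDr [LHS]addrACA; congr (_ + _).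
exact: addrC.
Qed.

HB.instance Definition _ := isZ2Graded.Build K U ugcomp_linear ugcompK ugcomp_sum.

Lemma usuper_homog_gen a (x : g) : homogeneous a x -> homogeneous a (usuper_gen x).
Proof.
rewrite /homogeneous /= => xa.
by rewrite [LHS](ugcomp_pi a (AGen x)) /= xa.
Qed.

Lemma usuper_homogM a b (p q : U) :
  homogeneous a p -> homogeneous b q -> homogeneous (a (+) b) (p * q).
Proof.
move=> pa qb; have E c r : ugcomp c r = gcomp c r by [].
rewrite /homogeneous /= -[LHS]E ugcompM !E !(homog_gcompE _ pa) !(homog_gcompE _ qb).
by case: a {pa}; case: b {qb}; rewrite /= ?(mul0r, mulr0, add0r, addr0).
Qed.

HB.instance Definition _ := Algebra_isSuper.Build K U usuper_homogM.
End SuperGrading.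

(* The bilinear extension of z u - (-1)^(|z||u|) u z. *)
Definition superbr (K : fieldType) (A : superAlgType K) (z u : A) : A :=
  \sum_(a : bool) \sum_(b : bool)
    (gcomp a z * gcomp b u - (-1) ^+ (a && b) *: (gcomp b u * gcomp a z)).

Lemma superbr_homog (K : fieldType) (A : superAlgType K) a b (z u : A) :
  homogeneous a z -> homogeneous b u ->
  superbr z u = z * u - (-1) ^+ (a && b) *: (u * z).
Proof.
move=> za ub; rewrite /superbr !big_bool /=.
rewrite !(homog_gcompE _ za) !(homog_gcompE _ ub).
by case: a {za}; case: b {ub};
  rewrite /= ?(mul0r, mulr0, scaler0, oppr0, addr0, add0r).
Qed.

Definition assoc_center (K : fieldType) (A : algType K) : set A :=
  [set z | forall u : A, z * u - u * z = 0]%classic.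

Definition super_center (K : fieldType) (A : superAlgType K) : set A :=
  [set z | forall u : A, superbr z u = 0]%classic.

Arguments assoc_center {K} A _.
Arguments super_center {K} A _.

(* The elements e_j, j in J, form a basis of the subspace V. *)
Definition family_basis (K : fieldType) (L : lmodType K) (I : choiceType)
    (V : set L) (J : {pred I}) (e : I -> L) : Prop :=
  (forall (s : seq I) (c : I -> K), uniq s -> {subset s <= J} ->
     \sum_(i <- s) c i *: e i = 0 -> {in s, forall i, c i = 0}) /\
  (forall x, V x <-> exists (s : seq I) (c : I -> K),
     {subset s <= J} /\ x = \sum_(i <- s) c i *: e i).

From mathcomp Require Import mpoly.

Section Subalgebras.
Variables (K : fieldType) (A : algType K).

Definition subalg_gen (X : set A) : set A :=
  [set z | forall S : {pred A}, GRing.subalg_closed S ->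
     (forall x, X x -> x \in S) -> z \in S]%classic.

(* The products in mmap are ordered; this is harmless for a family of pairwise
   commuting elements. *)
Definition alg_indep (X : Type) (v : X -> A) : Prop :=
  forall (n : nat) (t : 'I_n -> X), injective t ->
  forall p : mpoly n K,
    mmap (fun c : K => c%:A : A) (fun i => v (t i)) p = 0 -> p = 0.

Definition freely_generated (Z : set A) (X : Type) (v : X -> A) : Prop :=
  [/\ forall z w, Z z -> Z w -> z * w = w * z,
      Z = subalg_gen (range v) & alg_indep v].
End Subalgebras.

(* Main.v *)
From HB Require Import structures.
Require Import Defs.
From mathcomp Require Import all_boot all_order all_algebra.
From mathcomp Require Import finmap boolp classical_sets wochoice.
From mathcomp Require Import ring zify.
From mathcomp Require Import -(notations) mpoly.
From mathcomp Require Import monalg.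

Set Implicit Arguments.
Unset Strict Implicit.
Unset Printing Implicit Defensive.

Import GRing.Theory.

Local Open Scope ring_scope.

(* Let X index the basis (e_i tensor x^r), ordered first by the exponent r. The
   letters of X act on the free module over the sorted words in X by straightening;
   the relations of U hold for this action, which is the
   Poincare-Birkhoff-Witt theorem: the sorted monomials form a basis of U. If z is
   central and y = e_k tensor x^t with t large, the top degree part of [z, y] is
   obtained by replacing one letter m of a monomial of z by [m, y], which only
   involves exponents above all those of z. Moving [m, y] to the end gives sorted
   monomials, so that for every monomial N the combination of the letters m
   weighted by the coefficients of N m in z commutes with e_k, for all k. Its
   components thus lie in C(l); in characteristic 0 the weights do not vanish,
   hence the top part of z only involves the central letters, and one concludes by
   induction on the degree. Lie algebras are treated as Lie superalgebras all of
   whose basis elements are even. *)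

(** * Linear extension of maps given on the basis of a free module *)

Section LinearExtension.
Variables (K : fieldType) (X : choiceType) (W : lmodType K).

Definition lext (f : X -> W) (v : {malg K[X]}) : W :=
  \sum_(x <- msupp v) v@_x *: f x.

Lemma lextEw (f : X -> W) (v : {malg K[X]}) (D : {fset X}) :
  (msupp v `<=` D)%fset -> lext f v = \sum_(x <- D) v@_x *: f x.
Proof.
by move=> sD; apply: big_fset_incl => // x _ xv; rewrite mcoeff_outdom // scale0r.
Qed.

Lemma lext_is_linear (f : X -> W) : linear (lext f).
Proof.
move=> c v w.
pose D := (msupp (c *: v + w) `|` (msupp v `|` msupp w))%fset.
rewrite !(@lextEw f _ D) ?fsubsetUl //; last 2 first.
- by apply: fsubset_trans (fsubsetUr _ _); apply: fsubsetUr.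
- by apply: fsubset_trans (fsubsetUr _ _); apply: fsubsetUl.
rewrite scaler_sumr -big_split; apply: eq_bigr => x _ /=.
by rewrite mcoeffD mcoeffZ scalerDl scalerA.
Qed.

HB.instance Definition _ (f : X -> W) :=
  GRing.isLinear.Build K {malg K[X]} W *:%R (lext f) (lext_is_linear f).

Lemma lextUU (f : X -> W) c x : lext f << c *g x >> = c *: f x.
Proof. by rewrite (lextEw f msuppU_le) big_seq_fset1 mcoeffUU. Qed.

Lemma lextU (f : X -> W) x : lext f << x >> = f x.
Proof. by rewrite lextUU scale1r. Qed.

Lemma eq_lext (f g : X -> W) (v : {malg K[X]}) :
  {in msupp v, f =1 g} -> lext f v = lext g v.
Proof. by move=> e; apply: eq_big_seq => x xv; rewrite e. Qed.

Lemma lext0 (f : X -> W) (v : {malg K[X]}) :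
  {in msupp v, forall x, f x = 0} -> lext f v = 0.
Proof. by move=> e; rewrite /lext big_seq big1 // => x xv; rewrite e ?scaler0. Qed.

Lemma lext_addf (f g : X -> W) v : lext (fun x => f x + g x) v = lext f v + lext g v.
Proof. by rewrite /lext -big_split; apply: eq_bigr => x _; rewrite scalerDr. Qed.

Lemma lext_scalef c (f : X -> W) v : lext (fun x => c *: f x) v = c *: lext f v.
Proof.
by rewrite /lext scaler_sumr; apply: eq_bigr => x _; rewrite !scalerA mulrC.
Qed.

Lemma lext_comp (W' : lmodType K) (h : {linear W -> W'}) (f : X -> W) v :
  h (lext f v) = \sum_(x <- msupp v) v@_x *: h (f x).
Proof. by rewrite /lext linear_sum; apply: eq_bigr => x _; rewrite linearZ. Qed.
End LinearExtension.

Lemma lext_unit (K : fieldType) (X : choiceType) (v : {malg K[X]}) :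
  lext (fun x => << x >>) v = v.
Proof.
rewrite [RHS]monalgE; apply: eq_bigr => x _; apply/malgP => y.
by rewrite mcoeffZ !mcoeffU; case: eqP; rewrite ?mulr1 ?mulr0.
Qed.

Lemma msupp_lext (K : fieldType) (X Y : choiceType) (f : X -> {malg K[Y]})
    (v : {malg K[X]}) y :
  y \in msupp (lext f v) -> exists2 x, x \in msupp v & y \in msupp (f x).
Proof.
rewrite -mcoeff_neq0 => yv.
apply: contrapT => noe; move/eqP: yv; apply.
rewrite /lext raddf_sum big_seq big1 // => x xv /=.
rewrite mcoeffZ; case: (msuppP (f x) y) => [yx|_]; last by rewrite mulr0.
by case: noe; exists x.
Qed.

Lemma mem_msuppU (K : fieldType) (X : choiceType) (x y : X) :
  (y \in msupp (<< x >> : {malg K[X]})) = (y == x).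
Proof. by rewrite msuppU oner_eq0 in_fset1. Qed.

Lemma msuppDP (K : fieldType) (X : choiceType) (v w : {malg K[X]}) x :
  x \in msupp (v + w) -> x \in msupp v \/ x \in msupp w.
Proof. by move/(fsubsetP (msuppD_le _ _)); rewrite in_fsetU => /orP. Qed.

Lemma mem_msuppZ (K : fieldType) (X : choiceType) c (v : {malg K[X]}) x :
  x \in msupp (c *: v) -> x \in msupp v.
Proof. exact/fsubsetP/msuppZ_le. Qed.

Lemma lin_identity (K : fieldType) (W : lmodType K) (e c : K)
    (v1 w1 v2 w2 v3 w3 : W) :
  c *: v1 + w1 - e *: (c *: v2 + w2) - (c *: v3 + w3) =
  c *: (v1 - e *: v2 - v3) + (w1 - e *: w2 - w3).
Proof.
rewrite !scalerBr scalerDr !opprD !scalerA [e * c]mulrC.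
by rewrite [X in X + _ = _]addrACA [LHS]addrACA.
Qed.

(** The linear algebra behind [defect_cycle]: [p], [q] and [r] are the signs of the pairs (x, y),
    (y, z) and (x, z). Passing to coefficients turns it into an identity in [K] modulo the three
    square relations. *)
Lemma cycle_identity (K : fieldType) (Y : choiceType) (p q r : K)
    (v1 v2 v3 v4 v5 v6 v7 v8 : {malg K[Y]}) :
  p * p = 1 -> r * r = 1 -> q * q = 1 ->
  q *: v1 + ((p * r) *: v4 + (p *: v7 - (q * r) *: v8)) -
  p *: (r *: v2 + ((p * q) *: v5 + v7)) - v6 =
  q *: (v1 - r *: (p *: v3 + ((r * q) *: v6 + v8)) - v5) -
  (p * r) *: (v2 - q *: v3 - v4).
Proof.
move=> p2 r2 q2; apply/malgP => y.
rewrite !(mcoeffD, mcoeffN, mcoeffZ).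
by ring: p2 q2 r2.
Qed.

(** * The Poincare-Birkhoff-Witt theorem for Lie superalgebras *)

Section PBW.
Variables (K : fieldType) (K2 : 2%:R != 0 :> K) (K3 : 3%:R != 0 :> K).
Variables (X : choiceType) (le : rel X).
Hypotheses (le_total : total le) (le_anti : antisymmetric le) (le_trans : transitive
  le).
Variable par : X -> bool.
Variables (G : bracketAlgType K) (b : X -> G) (co : G -> {malg K[X]}).
Hypothesis co_linear : linear co.
Hypothesis co_b : forall x, co (b x) = << x >>.
Hypothesis coK : forall u, lext b (co u) = u.

(** Parity is read off the coordinates, so that [G] carries no grading and an ordinary Lie algebra
    fits with [par] constantly false. *)
Definition coord_homog a (u : G) := {in msupp (co u), forall x, par x = a}.

Definition eps (c d : bool) : K := (-1) ^+ (c && d).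

Hypothesis br_parity : forall x y, coord_homog (par x (+) par y) (br (b x) (b y)).
Hypothesis br_anti : forall x y,
  br (b x) (b y) = - (eps (par x) (par y) *: br (b y) (b x)).
Hypothesis br_jacobi : forall x y z,
  br (b x) (br (b y) (b z)) =
  br (br (b x) (b y)) (b z) + eps (par x) (par y) *: br (b y) (br (b x) (b z)).

HB.instance Definition _ := GRing.isLinear.Build K G {malg K[X]} *:%R co co_linear.

Local Notation V := {malg K[seq X]}.

Lemma epsC c d : eps c d = eps d c. Proof. by rewrite /eps andbC. Qed.
Lemma eps_sqr c d : eps c d * eps c d = 1.
Proof. by rewrite /eps; case: c; case: d; rewrite /= ?expr0 ?expr1 ?mulrNN mulr1. Qed.
Lemma epsD c d e : eps (c (+) d) e = eps c e * eps d e.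
Proof.
rewrite /eps; case: c; case: d; case: e;
  rewrite /= ?expr0 ?expr1 ?mulrNN ?mulr1 ?mul1r //.
Qed.

Lemma epsDr c d e : eps c (d (+) e) = eps c d * eps c e.
Proof. by rewrite epsC epsD !(epsC c). Qed.
Lemma eps0l d : eps false d = 1. Proof. by rewrite /eps expr0. Qed.

(* Normal words are the [ok]-sorted ones: odd letters are not repeated. *)
Definition ok : rel X := fun x y => le x y && ((x != y) || ~~ par x).
Local Notation normal := (sorted ok).

Lemma le_refl : reflexive le.
Proof. by move=> x; have := le_total x x; rewrite orbb. Qed.

Lemma ok_trans : transitive ok.
Proof.
move=> y x z /andP[xy xy'] /andP[yz yz']; rewrite /ok (le_trans xy yz) /=.
case: eqP => //= e; subst z; have e : x = y by apply: le_anti; rewrite xy yz.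
by subst y; move: xy'; rewrite eqxx.
Qed.

Lemma ok_total x y : x != y -> ~~ ok x y -> ok y x.
Proof.
move=> xy; rewrite /ok xy andbT => nle.
by have := le_total x y; rewrite (negPf nle) /= => ->; rewrite eq_sym xy.
Qed.

Lemma ok_asym x y : x != y -> ok x y -> ok y x = false.
Proof.
move=> xy /andP[lxy _]; apply/negP => /andP[lyx _].
by move/eqP: xy; apply; apply: le_anti; rewrite lxy.
Qed.

Lemma normal_cons x w : normal (x :: w) = all (ok x) w && normal w.
Proof.
by rewrite /= path_sortedE //; exact: ok_trans.
Qed.

Local Notation cc x y := (co (br (b x) (b y))).

(* Action of the letter x on the normal word w. The fuel n is sufficient as soon as
   size w <= n: a word of actn n' x w' is either not longer than w', or a sorted
   permutation of x :: w', on which y acts by concatenation. *)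
Fixpoint actn (n : nat) (x : X) (w : seq X) : V :=
  if w is y :: w' then
    if ok x y then << x :: w >> else
    if n is n'.+1 then
      if x == y then 2^-1 *: lext (actn n' ^~ w') (cc x x)
      else lext (actn n' ^~ w') (cc x y)
           + eps (par x) (par y) *: lext (actn n' y) (actn n' x w')
    else 0
  else << [:: x] >>.

Lemma actn_consS n x y w : actn n.+1 x (y :: w) =
  if ok x y then << [:: x, y & w] >>
  else if x == y then 2^-1 *: lext (actn n ^~ w) (cc x x)
  else lext (actn n ^~ w) (cc x y)
       + eps (par x) (par y) *: lext (actn n y) (actn n x w).
Proof. by []. Qed.

Lemma actn_base n x w : all (ok x) w -> actn n x w = << x :: w >>.
Proof. by case: w n => [|y w] [|n] //=; case/andP=> -> _. Qed.

Definition leading_bound x w u :=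
  normal u && ((size u <= size w)%N || perm_eq u (x :: w)).

(** The triangularity behind the whole construction: a bracket replaces two letters by one, so only
    the sorted rearrangement of [x :: w] can be longer than [w]. *)
Lemma actn_supp n x w u :
  normal w -> u \in msupp (actn n x w) -> leading_bound x w u.
Proof.
elim: n x w u => [|n IH] x w u.
  case: w => [|y w] nw /=; first by rewrite mem_msuppU => /eqP ->;
    rewrite /leading_bound /=.
  case: ifP => xy; last by rewrite msupp0.
  by rewrite mem_msuppU => /eqP ->; rewrite /leading_bound perm_refl orbT andbT /= xy.
case: w => [|y w] nw /=; first by rewrite mem_msuppU => /eqP ->;
  rewrite /leading_bound /=.
have nw' : normal w by move: nw; rewrite normal_cons => /andP[].
have ayw : all (ok y) w by move: nw; rewrite normal_cons => /andP[].
case: ifP => xy.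
  by rewrite mem_msuppU => /eqP ->; rewrite /leading_bound perm_refl orbT andbT /= xy.
have low v u' : u' \in msupp (lext (actn n ^~ w) v) -> leading_bound x (y :: w) u'.
  case/msupp_lext => z _ /(IH _ _ _ nw') /andP[nu /orP[su|/perm_size su]].
    by rewrite /leading_bound nu /= (leq_trans su).
  by rewrite /leading_bound nu /= su leqnn.
case: eqP => [_|/eqP xny]; first by move/mem_msuppZ/low.
case/msuppDP => [/low //|/mem_msuppZ/msupp_lext [u' /(IH _ _ _ nw')]].
case/andP=> nu' /orP[su' /(IH _ _ _ nu')|pu'].
  case/andP=> nu su; rewrite /leading_bound nu /= (_ : (size u <= (size w).+1)%N) //.
  by case/orP: su => [su|/perm_size ->] /=; [apply: leq_trans su _; apply: leqW|].
have yx : ok y x by apply: ok_total => //; rewrite xy.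
have ayu' : all (ok y) u' by rewrite (perm_all _ pu') /=; move: yx => /= ->.
rewrite actn_base // mem_msuppU => /eqP ->.
rewrite /leading_bound normal_cons ayu' nu' /=; apply/orP; right.
by apply/permP => p; rewrite /= (permP pu') /= addnCA.
Qed.

Lemma actn_stable n x w : normal w -> (size w <= n)%N ->
  actn n x w = actn (size w) x w.
Proof.
suff S m y u : normal u -> (size u <= m)%N -> actn m.+1 y u = actn m y u.
  move=> nw; elim: n => [|n IH]; first by rewrite leqn0 => /eqP ->.
  by rewrite leq_eqVlt => /orP[/eqP <- //|sn]; rewrite S // IH.
elim: m y u => [|m IH] x' [|y u]; [by []|by []|by []|move=> nu su].
have [ayu nu'] : all (ok y) u /\ normal u by apply/andP; rewrite -normal_cons.
apply: etrans (actn_consS m.+1 x' y u) _.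
apply: (etrans _ (esym (actn_consS m x' y u))).
case xy: (ok x' y); first reflexivity.
have E v : lext (actn m.+1 ^~ u) v = lext (actn m ^~ u) v.
  by apply: eq_lext => z _; apply: IH.
rewrite !E; case: (x' =P y) => [_|/eqP xny]; first reflexivity.
congr (_ + _ *: _); rewrite (IH x' u nu' su).
apply: eq_lext => u' /(actn_supp nu')/andP[nu'' /orP[su'|pu']].
  by apply: IH nu'' _; apply: leq_trans su' _.
have ayu' : all (ok y) u' by rewrite (perm_all _ pu') /= ayu ok_total // xy.
by rewrite !actn_base.
Qed.

(** Non-normal words are sent to 0: the operators are then defined on all of [V], and the relations
    hold trivially on such words. *)
Definition act x w : V := if normal w then actn (size w) x w else 0.

Definition letter_op x : V -> V := lext (act x).
Local Notation T := letter_op.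
HB.instance Definition _ x := GRing.Linear.on (T x).

Lemma letter_opP x c v w : T x (c *: v + w) = c *: T x v + T x w.
Proof. exact: linearP. Qed.

Lemma act_base x w : normal (x :: w) -> act x w = << x :: w >>.
Proof. by rewrite normal_cons => /andP[aw nw]; rewrite /act nw actn_base. Qed.

Lemma act_supp x w u : u \in msupp (act x w) -> leading_bound x w u.
Proof. by rewrite /act; case: ifP => nw; [exact: actn_supp|rewrite msupp0]. Qed.

(** The straightening rule without fuel, since by [actn_supp] the fuel left suffices for every word
    that occurs. The case [x == y] concerns an odd letter, whose square is half of its bracket with
    itself. *)
Lemma act_cons x y w : normal (y :: w) -> ~~ ok x y ->
  act x (y :: w) =
  if x == y then 2^-1 *: lext (act ^~ w) (cc x x)
  else lext (act ^~ w) (cc x y) + eps (par x) (par y) *: T y (act x w).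
Proof.
move=> nyw xy; have := nyw; rewrite normal_cons => /andP[ayw nw].
rewrite {1}/act nyw; apply: (etrans (actn_consS (size w) x y w)); rewrite (negPf xy).
have E v : lext (actn (size w) ^~ w) v = lext (act ^~ w) v.
  by apply: eq_lext => z _; rewrite /act nw.
case: (x =P y) => [_|/eqP xny]; first exact: (congr1 _ (E _)).
apply: (congr2 _ (E _)); apply: (congr1 (fun v => _ *: v)).
have -> : act x w = actn (size w) x w by rewrite /act nw.
apply: eq_lext => u /(actn_supp nw)/andP[nu /orP[su|pu]].
  by rewrite /act nu (actn_stable y nu su).
have ayu : all (ok y) u by rewrite (perm_all _ pu) /= ayw ok_total.
by rewrite /act nu !actn_base.
Qed.

(** * The supercommutation relations hold for the action on sorted words *)

Definition vec_op (g : G) (v : V) : V := lext (fun x => T x v) (co g).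
Local Notation TT := vec_op.

Lemma vec_op_linear g : linear (TT g).
Proof.
move=> c v w; rewrite /TT -lext_scalef -lext_addf.
by congr lext; apply/funext => x; rewrite linearP.
Qed.

HB.instance Definition _ g := GRing.isLinear.Build K V V *:%R (TT g) (vec_op_linear g).

Lemma vec_opPr g c v w : TT g (c *: v + w) = c *: TT g v + TT g w.
Proof. exact: linearP. Qed.
Lemma vec_opP c g h v : TT (c *: g + h) v = c *: TT g v + TT h v.
Proof. by rewrite /TT !linearP. Qed.
Lemma vec_opZ c g v : TT (c *: g) v = c *: TT g v.
Proof. by rewrite /TT !linearZ. Qed.
Lemma vec_opD g h v : TT (g + h) v = TT g v + TT h v.
Proof. by rewrite /TT !linearD. Qed.
Lemma vec_opN g v : TT (- g) v = - TT g v.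
Proof. by rewrite /TT !linearN. Qed.
Lemma vec_op_b x v : TT (b x) v = T x v.
Proof. by rewrite /TT co_b lextU. Qed.
Lemma letter_opU x w : T x << w >> = act x w.
Proof. by rewrite /T lextU. Qed.
Lemma vec_opU g w : TT g << w >> = lext (act ^~ w) (co g).
Proof. by apply: eq_lext => x _; rewrite letter_opU. Qed.

(** The obstruction to [V] being a module over the enveloping algebra; the aim is [defect0]. *)
Definition defect x y (v : V) : V :=
  T x (T y v) - eps (par x) (par y) *: T y (T x v) - TT (br (b x) (b y)) v.
Local Notation R := defect.

Lemma defect_linear x y : linear (R x y).
Proof.
move=> c v w; rewrite /R (letter_opP y c v w) (letter_opP x c v w) vec_opPr.
rewrite (letter_opP x c (T y v)) (letter_opP y c (T x v)).
exact: lin_identity.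
Qed.

HB.instance Definition _ x y := GRing.isLinear.Build K V V *:%R (R x y) (defect_linear
  x y).

Lemma defectC x y v : R x y v = - (eps (par x) (par y) *: R y x v).
Proof.
rewrite /R br_anti vec_opN vec_opZ (epsC (par y)); have e := eps_sqr (par x) (par y).
by rewrite !scalerBr scalerA e scale1r !opprB opprK addrC.
Qed.

HB.instance Definition _ (g : G) := GRing.isLinear.Build K G G *:%R (br g) (br_linearr
  g).
Lemma vec_op0 v : TT 0 v = 0. Proof. by rewrite /TT !linear0. Qed.
Lemma letter_opD x v w : T x (v + w) = T x v + T x w. Proof. exact: linearD. Qed.
Lemma letter_opZ x c v : T x (c *: v) = c *: T x v. Proof. exact: linearZ. Qed.

Lemma coord_ind (P : G -> Prop) a : P 0 ->
    (forall c x g, par x = a -> P g -> P (c *: b x + g)) ->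
  forall g, coord_homog a g -> P g.
Proof.
move=> P0 PD g ga; rewrite -[g]coK /lext big_seq.
by elim/big_rec: _ => // x h xg Ph; apply: PD => //; apply: ga.
Qed.

Lemma br_anti_homog a g z : coord_homog a g ->
  br g (b z) = - (eps a (par z) *: br (b z) g).
Proof.
move=> ga; move: g ga; apply: coord_ind => [|c x g <- IH].
  by rewrite br0l br0r scaler0 oppr0.
rewrite brDl brZl IH br_anti brDr brZr scalerDr opprD !scalerN.
by rewrite !scalerA mulrC.
Qed.

Lemma letter_vec_op x a g v : (forall y, R x y v = 0) -> coord_homog a g ->
  T x (TT g v) = eps (par x) a *: TT g (T x v) + TT (br (b x) g) v.
Proof.
move=> Rv ga; move: g ga; apply: coord_ind => [|c y g <- IH].
  by by rewrite br0r !vec_op0 linear0 scaler0 addr0.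
rewrite !vec_opP letter_opP IH brDr brZr vec_opP !vec_op_b.
have /eqP := Rv y; rewrite /R -addrA -opprD subr_eq0 => /eqP ->.
by rewrite !scalerDr !scalerA [RHS]addrACA [c * _]mulrC.
Qed.

(* The overlap ambiguity x y z of the straightening, resolved by the Jacobi
   identity. *)
Lemma defect_cycle x y z v : (forall x' y', R x' y' v = 0) ->
  R x y (T z v) = eps (par y) (par z) *: R x z (T y v)
    - (eps (par x) (par y) * eps (par x) (par z)) *: R y z (T x v).
Proof.
move=> Rv.
have E x' y' : T x' (T y' v) =
    eps (par x') (par y') *: T y' (T x' v) + TT (br (b x') (b y')) v.
  by have /eqP := Rv x' y'; rewrite /R -addrA -opprD subr_eq0 => /eqP.
have F x' y' z' := letter_vec_op (Rv x') (@br_parity y' z').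
have J : TT (br (b x) (br (b y) (b z))) v =
    eps (par x) (par y) *: TT (br (b y) (br (b x) (b z))) v
    - (eps (par y) (par z) * eps (par x) (par z)) *: TT (br (b z) (br (b x) (b y))) v.
  rewrite br_jacobi vec_opD vec_opZ addrC; congr (_ + _).
  by rewrite (br_anti_homog _ (@br_parity x y)) vec_opN vec_opZ epsD mulrC.
rewrite /R (E y z) (E x z) !letter_opD !letter_opZ (E x y) letter_opD letter_opZ.
rewrite !F J !epsDr !(epsC (par z)) (epsC (par y) (par x)).
have := eps_sqr (par y) (par z); have := eps_sqr (par x) (par z).
have := eps_sqr (par x) (par y).
move=> p2 r2 q2.
exact: cycle_identity.
Qed.

Lemma self_br_even x : ~~ par x -> br (b x) (b x) = 0.
Proof.
move=> px; have /eqP := br_anti x x; rewrite (negPf px) eps0l scale1r -addr_eq0.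
by rewrite -mulr2n -scaler_nat scaler_eq0 (negPf K2) => /eqP.
Qed.

(** At a descent the straightening rule is the relation itself. For an odd letter [x = y] the two
    products add up, which cancels the factor 1/2. *)
Lemma defect_descent x y w : normal (y :: w) -> ~~ ok x y -> R x y << w >> = 0.
Proof.
move=> nyw xy; have := act_cons nyw xy.
rewrite /R [T y << w >>]letter_opU (act_base nyw) [T x << _ :: _ >>]letter_opU => ->.
rewrite vec_opU; case: (x =P y) => [e|_]; last first.
  by rewrite [T x << w >>]letter_opU addrK subrr.
subst y; have px : par x by apply: contraNT xy => px; rewrite /ok le_refl px orbT.
rewrite [T x << w >>]letter_opU (act_base nyw) letter_opU (act_cons nyw xy) eqxx.
rewrite px /eps expr1 scaleN1r opprK -scalerDl -[X in X - _]scale1r.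
rewrite scale1r (_ : 2^-1 + 2^-1 = 1 :> K) ?scale1r ?subrr //.
by rewrite -mulr2n -[LHS]mulr_natr mulVf.
Qed.

(** If [x], [y] is not a descent, then [x] can also be put in front of [w], and [defectC] exchanges
    the two letters. For [x = y] the letter is even and its bracket with itself vanishes. *)
Lemma normal_defect0 x y w : normal (y :: w) -> R x y << w >> = 0.
Proof.
move=> nyw; case xy: (ok x y); last by apply: defect_descent; rewrite ?xy.
move: (nyw); rewrite normal_cons => /andP[ayw nw].
have nxw : normal (x :: w).
  rewrite normal_cons nw andbT; apply/allP => z zw.
  exact: ok_trans xy (allP ayw _ zw).
case: (eqVneq x y) => [e|xny].
  subst y; have px : ~~ par x by move: xy; rewrite /ok eqxx => /andP[].
  by rewrite /R self_br_even // vec_op0 (negPf px) eps0l scale1r subrr subr0.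
rewrite defectC defect_descent ?scaler0 ?oppr0 //.
by rewrite ok_asym.
Qed.

Lemma defect_ext x y v : {in msupp v, forall w, R x y << w >> = 0} -> R x y v = 0.
Proof.
move=> v0; rewrite -[v]lext_unit lext_comp big_seq big1 // => w wv /=.
by rewrite v0 ?scaler0.
Qed.

(** Induction on the length. Unless [x] or [y] can be put in front of the word, its first letter [z]
    is split off as an operator and [defect_cycle] reduces the claim to defects involving [z]. *)
Lemma defect_word0 n w x y : (size w < n)%N -> R x y << w >> = 0.
Proof.
elim: n w x y => // n IH w x y; rewrite ltnS => sw.
case nw : (normal w); last first.
  have a0 z : act z w = 0 by rewrite /act nw.
  rewrite /R ![T _ << w >>]letter_opU !a0 !linear0 ?scaler0 vec_opU.
  by rewrite lext0 ?subr0 ?addr0 // => z _; apply: a0.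
case: w nw sw => [|z w] nzw sw; first exact: normal_defect0.
move: (nzw); rewrite normal_cons => /andP[azw nw].
have nok x' : ok x' z -> normal (x' :: z :: w).
  move=> xz; rewrite normal_cons nzw andbT /= xz; apply/allP => u uw.
  exact: ok_trans xz (allP azw _ uw).
case yz : (ok y z); first exact/normal_defect0/nok.
case xz : (ok x z).
  by rewrite defectC normal_defect0 ?scaler0 ?oppr0 //; apply: nok.
(* The words of [T y' << w >>] are either no longer than [w], hence covered by the induction, or
   rearrangements of [y' :: w], in front of which [z] can be put. *)
have D x' y' : y' != z -> ok y' z = false -> R x' z (T y' << w >>) = 0.
  move=> y'z oy'z; rewrite letter_opU; apply: defect_ext => u.
  case/act_supp/andP=> nu /orP[su|pu]; first by apply: IH; apply: leq_ltn_trans su sw.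
  apply: normal_defect0; rewrite normal_cons nu andbT (perm_all _ pu) /= azw andbT.
  by apply: ok_total => //; rewrite oy'z.
have -> : << z :: w >> = T z << w >> by rewrite letter_opU act_base.
have cyc := @defect_cycle x y z << w >> (fun x' y' => IH w x' y' sw).
have double v : v = - v -> v = 0 :> V.
  move/eqP; rewrite -addr_eq0 -mulr2n -scaler_nat scaler_eq0 (negPf K2) /=.
  by move/eqP.
have odd u : ok u z = false -> u = z -> par z.
  by move=> + uz; rewrite uz /ok le_refl eqxx /=; case: (par z).
have [yz'|yz'] := eqVneq y z; have [xz'|xz'] := eqVneq x z.
(* For [x = y = z], an odd letter, the cycle relation reads v = - v - v, so 3 v = 0. *)
- have pz := odd y yz yz'; subst x y; move: cyc; rewrite pz /eps /= expr1.
  rewrite mulrNN mulr1 scale1r scaleN1r => e.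
  move: (R z z _) e => v e; have : 3%:R *: v = 0.
    by rewrite scaler_nat !mulrS mulr0n addr0 {1}e -opprD addNr.
  by move/eqP; rewrite scaler_eq0 (negPf K3) => /eqP.
(* If exactly one of [x], [y] equals [z], one defect vanishes by [D] and the other is the unknown
   again, up to sign: v = - v. *)
- have pz := odd y yz yz'; subst y; move: cyc.
  rewrite [R z z _]D // scaler0 subr0 pz /eps expr1 scaleN1r; exact: double.
- have pz := odd x xz xz'; subst x; move: cyc.
  rewrite [R z z _]D // scaler0 sub0r [R y z _]defectC scalerN opprK !scalerA.
  rewrite pz (epsC (par y)) mulrAC eps_sqr mul1r /eps expr1 scaleN1r.
  exact: double.
apply: (etrans cyc); rewrite -[RHS](subrr (0 : V)); congr (_ - _).
  by rewrite D // scaler0.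
by rewrite D // scaler0.
Qed.

Lemma defect0 x y v : R x y v = 0.
Proof. by apply: defect_ext => w _; apply: (@defect_word0 (size w).+1). Qed.

Lemma vec_op_homog a c g h v : coord_homog a g -> coord_homog c h ->
  TT g (TT h v) = eps a c *: TT h (TT g v) + TT (br g h) v.
Proof.
move=> ga hc; move: g ga; apply: coord_ind => [|d x g <- IH].
  by rewrite br0l !vec_op0 linear0 scaler0 addr0.
have E := letter_vec_op (fun y => defect0 x y v) hc.
rewrite !vec_opP IH brDl brZl vec_opP !vec_op_b E vec_opPr.
by rewrite !scalerDr !scalerA [RHS]addrACA [d * _]mulrC.
Qed.

(** * The action of the enveloping algebra and the basis of sorted monomials *)

Variable rel : G -> G -> K -> G -> Prop.
(** The relation stays abstract so that [lie_rel] and [lieSuper_rel] are treated at once: every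
    relation is a homogeneous supercommutation relation, and those between basis elements all
    occur. *)
Hypothesis rel_homog : forall g h c k, rel g h c k -> exists a d,
  [/\ coord_homog a g, coord_homog d h, c = eps a d & k = br g h].
Hypothesis rel_b : forall x y,
  rel (b x) (b y) (eps (par x) (par y)) (br (b x) (b y)).

Local Notation U := (palg rel).
Local Notation gen := (pgen rel).
HB.instance Definition _ := GRing.isLinear.Build K G U *:%R gen (pgen_linear rel).

Fixpoint interp (t : aterm G) (v : V) : V :=
  match t with
  | AConst c => c *: v
  | AGen g => TT g v
  | AAdd t u => interp t v + interp u v
  | AMul t u => interp t (interp u v)
  end.

Lemma interp_linear t : linear (interp t).
Proof.
move=> c v w; elim: t v w => [d|g|t It u Iu|t It u Iu] v w /=.
- by rewrite scalerDr !scalerA mulrC.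
- exact: vec_opPr.
- by rewrite It Iu scalerDr addrACA.
- by rewrite Iu It.
Qed.

(** The action descends to [U]: the defining relations are [vec_op_homog], and the remaining rules
    hold for linear operators on any space. *)
Lemma interp_cong t u : acong rel t u -> interp t =1 interp u.
Proof.
elim=> //= {t u}.
- by move=> t u _ e v; rewrite e.
- by move=> t u v _ e1 _ e2 z; rewrite e1 e2.
- by move=> t t' u u' _ e1 _ e2 z; rewrite e1 e2.
- by move=> t t' u u' _ e1 _ e2 z; rewrite e1 e2.
- by move=> t u v z /=; rewrite addrA.
- by move=> t u z /=; rewrite addrC.
- by move=> t z /=; rewrite scale0r add0r.
- by move=> t z /=; rewrite scale1r.
- by move=> t z /=; rewrite !scale0r.
- by move=> t u v z /=; have := interp_linear t 1 (interp u z) (interp v z);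
    rewrite !scale1r.
- by move=> c d z /=; rewrite scalerDl.
- by move=> c d z /=; rewrite scalerA.
- move=> c t z /=; have := interp_linear t (-1) 0 0.
  rewrite scaler0 addr0 scaleN1r addNr => t0.
  by have := interp_linear t c z 0; rewrite t0 !addr0.
- by move=> c g h z; rewrite /= vec_opP.
move=> g h c k /rel_homog[a [d [ga hd -> ->]]] z.
exact: vec_op_homog.
Qed.

Definition uact (p : U) (v : V) : V := interp (prep p) v.

Lemma uact_ppi t v : uact (ppi rel t) v = interp t v.
Proof. exact: (interp_cong (prep_ppi rel t)). Qed.
Lemma uactD p q v : uact (p + q) v = uact p v + uact q v.
Proof. by rewrite -[p]prepK -[q]prepK -ppiD !uact_ppi. Qed.
Lemma uactM p q v : uact (p * q) v = uact p (uact q v).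
Proof. by rewrite -[p]prepK -[q]prepK -ppiM !uact_ppi. Qed.
Lemma uact_const c v : uact c%:A v = c *: v.
Proof. by rewrite -ppiC uact_ppi. Qed.
Lemma uact_gen g v : uact (gen g) v = TT g v.
Proof. exact: uact_ppi. Qed.
Lemma uactZ c p v : uact (c *: p) v = c *: uact p v.
Proof. by rewrite -[p]mul1r scalerAl uactM uact_const mul1r. Qed.

(** The coordinates of [p] in the basis of sorted monomials, as [symb_mon] and [symbK] show. *)
Definition symb (p : U) : V := uact p << [::] >>.
Lemma symb_linear : linear symb.
Proof. by move=> c p q; rewrite /symb uactD uactZ. Qed.
HB.instance Definition _ := GRing.isLinear.Build K U V *:%R symb symb_linear.

Lemma symb1 : symb 1 = << [::] >>.
Proof. by rewrite /symb -[1]scale1r uact_const scale1r. Qed.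
Lemma symb_genM g p : symb (gen g * p) = TT g (symb p).
Proof. by rewrite /symb uactM uact_gen. Qed.

Definition mon (w : seq X) : U := \prod_(x <- w) gen (b x).
Lemma mon_cons x w : mon (x :: w) = gen (b x) * mon w.
Proof. exact: big_cons. Qed.
Lemma mon_cat w w' : mon (w ++ w') = mon w * mon w'.
Proof. exact: big_cat. Qed.

Lemma symb_mon w : normal w -> symb (mon w) = << w >>.
Proof.
elim: w => [|x w IH] nw; first by rewrite /mon big_nil symb1.
rewrite mon_cons symb_genM IH; last by move: nw; rewrite normal_cons => /andP[].
by rewrite vec_op_b letter_opU act_base.
Qed.

Lemma gen_lext g : gen g = lext (fun x => gen (b x)) (co g).
Proof. by rewrite -{1}[g]coK lext_comp. Qed.

Lemma gen_swap x y : gen (b x) * gen (b y) =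
  eps (par x) (par y) *: (gen (b y) * gen (b x)) + gen (br (b x) (b y)).
Proof. exact: pgen_rel. Qed.

Definition normal_vec (v : V) := {in msupp v, forall w, normal w}.

Local Notation Phi := (lext mon).

Lemma lext_mon_lift g v :
  {in msupp (co g) & msupp v,
     forall x w, Phi (act x w) = gen (b x) * mon w} ->
  Phi (TT g v) = gen g * Phi v.
Proof.
move=> Iv; rewrite [gen g]gen_lext /TT lext_comp mulr_suml.
apply: eq_big_seq => x xg; rewrite -scalerAl; congr (_ *: _).
rewrite /T lext_comp mulr_sumr big_seq [RHS]big_seq; apply: eq_bigr => w wv.
by rewrite /= Iv // scalerAr.
Qed.

(** Each step of the straightening in [V] mirrors a relation of [U]; induction on the length of [w],
    the rearrangements of full length being handled by concatenation. *)
Lemma lext_mon_act x w : normal w -> Phi (act x w) = gen (b x) * mon w.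
Proof.
have base z u : normal (z :: u) -> Phi (act z u) = gen (b z) * mon u.
  by move=> nzu; rewrite act_base // lextU mon_cons.
have [n] := ubnP (size w); elim: n w x => // n IH w x; rewrite ltnS => sw nw.
case: w nw sw => [|y w] nyw sw; first exact: base.
move: (nyw); rewrite normal_cons => /andP[ayw nw].
case xy : (ok x y).
  by apply: base; rewrite normal_cons nyw andbT /= xy; apply/allP => u /(allP ayw);
    apply: ok_trans.
have E g : Phi (lext (act ^~ w) (co g)) = gen g * mon w.
  by rewrite -vec_opU lext_mon_lift ?lextU // => z u _;
    rewrite mem_msuppU => /eqP ->; apply: IH.
rewrite act_cons ?xy // mon_cons mulrA; case: (x =P y) => [e|/eqP xny].
  subst y; have px : par x by apply: contraFT xy => px; rewrite /ok le_refl px orbT.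
  rewrite linearZ /= E; have /eqP := gen_swap x x.
  rewrite px /eps expr1 scaleN1r addrC eq_sym subr_eq => /eqP ->.
  by rewrite mulrDl -mulr2n -scaler_nat scalerA mulVf // scale1r.
rewrite gen_swap linearD linearZ /= E mulrDl addrC -scalerAl; congr (_ *: _ + _).
rewrite -vec_op_b lext_mon_lift ?IH ?mulrA // => z u.
rewrite co_b mem_msuppU => /eqP -> /act_supp/andP[nu /orP[su|pu]];
  first by apply: IH => //; apply: leq_ltn_trans su sw.
apply: base; rewrite normal_cons nu andbT (perm_all _ pu) /= ayw andbT.
by apply: ok_total; rewrite ?xy.
Qed.

Lemma normal_vec_lext (Y : choiceType) (f : Y -> V) v :
  {in msupp v, forall y, normal_vec (f y)} -> normal_vec (lext f v).
Proof. by move=> fn w /msupp_lext[y yv]; apply: fn. Qed.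

Lemma vec_op_normal g v : normal_vec (TT g v).
Proof.
by do 2!apply: normal_vec_lext => ? _; move=> w /act_supp/andP[].
Qed.

Lemma normal_vecZ c v : normal_vec v -> normal_vec (c *: v).
Proof. by move=> nv w /mem_msuppZ/nv. Qed.
Lemma normal_vecD v w : normal_vec v -> normal_vec w -> normal_vec (v + w).
Proof. by move=> nv nw u /msuppDP[/nv|/nw]. Qed.

Lemma interp_normal t v : normal_vec v -> normal_vec (interp t v).
Proof.
elim: t v => [c|g|t It u Iu|t It u Iu] v nv /=.
- exact: normal_vecZ.
- exact: vec_op_normal.
- by apply: normal_vecD; [apply: It|apply: Iu].
- exact/It/Iu.
Qed.

Lemma nil_normal : normal_vec << [::] >>.
Proof. by move=> w; rewrite mem_msuppU => /eqP ->. Qed.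

Lemma symb_normal p : normal_vec (symb p).
Proof. exact/interp_normal/nil_normal. Qed.

Lemma mon_uact t v : normal_vec v -> Phi (interp t v) = ppi rel t * Phi v.
Proof.
elim: t v => [c|g|t It u Iu|t It u Iu] v nv /=.
- by rewrite linearZ /= ppiC -scalerAl mul1r.
- by rewrite lext_mon_lift // => x w _ wv; apply: lext_mon_act; apply: nv.
- by rewrite linearD /= It // Iu // ppiD mulrDl.
by rewrite It ?Iu ?ppiM ?mulrA //; apply: interp_normal.
Qed.

(** Spanning by sorted monomials: [Phi] is compatible with the two actions by [mon_uact], and it
    sends the empty word to 1. Independence is [symb_mon]. *)
Lemma symbK : cancel symb Phi.
Proof.
move=> p; rewrite /symb mon_uact; last exact: nil_normal.
by rewrite prepK lextU /mon big_nil mulr1.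
Qed.

(** * Central elements *)

(** The degree filtration of [U], shifted by one so that [low 0 p] forces [p = 0] and can start an
    induction. *)
Definition low n (p : U) := {in msupp (symb p), forall w, (size w < n)%N}.

Lemma low_le m n p : (m <= n)%N -> low m p -> low n p.
Proof. by move=> mn lp w /lp sw; apply: leq_trans sw mn. Qed.
Lemma low0 n : low n 0.
Proof. by move=> w; rewrite linear0 msupp0. Qed.
Lemma lowD n p q : low n p -> low n q -> low n (p + q).
Proof. by move=> lp lq w; rewrite linearD => /msuppDP[/lp|/lq]. Qed.
Lemma lowZ n c p : low n p -> low n (c *: p).
Proof. by move=> lp w; rewrite linearZ => /mem_msuppZ/lp. Qed.
Lemma low_lext n (Y : choiceType) (f : Y -> U) v :
  {in msupp v, forall y, low n (f y)} -> low n (lext f v).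
Proof.
move=> lf; rewrite /lext big_seq.
by elim/big_rec: _ => [|y p yv lp]; [exact: low0|apply/lowD/lp/lowZ/lf].
Qed.

Lemma low_genM n g p : low n p -> low n.+1 (gen g * p).
Proof.
move=> lp w; rewrite symb_genM => /msupp_lext[x _ /msupp_lext[u /lp su]].
case/act_supp/andP=> _ /orP[sw|/perm_size ->]; last by rewrite ltnS.
by rewrite ltnS; apply: leq_trans sw (ltnW su).
Qed.

Lemma low_mon w : low (size w).+1 (mon w).
Proof.
elim: w => [|x w IH]; last by rewrite mon_cons; apply: low_genM.
by rewrite /mon big_nil => w; rewrite symb1 mem_msuppU => /eqP ->.
Qed.

Definition word_par : seq X -> bool := foldr (fun x => addb (par x)) false.

Lemma gen_swap_homog a g x : coord_homog a g ->
  gen g * gen (b x) = eps a (par x) *: (gen (b x) * gen g) + gen (br g (b x)).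
Proof.
move=> ga; move: g ga; apply: coord_ind => [|c y g <- IH].
  by rewrite br0l !linear0 mul0r mulr0 scaler0 addr0.
rewrite brDl brZl !linearP /= mulrDl IH mulrDr -scalerAl gen_swap -scalerAr.
by rewrite !scalerDr !scalerA [RHS]addrACA [c * _]mulrC.
Qed.

(** The associated graded algebra is supercommutative: passing each letter costs a bracket, which
    lowers the degree by one. *)
Lemma gen_mon_swap a g w : coord_homog a g ->
  low (size w).+1 (gen g * mon w - eps a (word_par w) *: (mon w * gen g)).
Proof.
move=> ga; elim: w => [|x w IH].
  by rewrite /mon big_nil mulr1 mul1r /eps andbF expr0 scale1r subrr; apply: low0.
rewrite mon_cons mulrA (gen_swap_homog _ ga) [word_par _]/= epsDr.
rewrite mulrDl -scalerAl -!mulrA addrAC -scalerA -scalerBr scalerAr -mulrBr.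
apply: lowD; first exact/lowZ/low_genM.
exact/low_genM/low_mon.
Qed.

(* The formal sum of the pairs (w with one letter x removed, x), each with the
   sign of moving x to the end of w. *)
Fixpoint delta (w : seq X) : {malg K[(seq X * X)%type]} :=
  if w is x :: w' then
    eps (par x) (word_par w') *: << (w', x) >>
    + lext (fun q => << (x :: q.1, q.2) >>) (delta w')
  else 0.

Definition br_last y (q : seq X * X) : U := mon q.1 * gen (br (b q.2) (b y)).

(** The Leibniz rule for the bracket with [y], modulo lower degree. It produces [x, y] in the place
    of x; [gen_mon_swap] moves it to the end, and the sign of [y] against the rest of the word
    cancels by [eps_sqr]. *)
Lemma mon_gen_delta y w :
  low (size w) (mon w * gen (b y) - eps (par y) (word_par w) *: (gen (b y) * mon w)
                - lext (br_last y) (delta w)).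
Proof.
elim: w => [|x w IH].
  rewrite /mon big_nil mulr1 mul1r /eps andbF expr0 scale1r subrr sub0r linear0 oppr0.
  exact: low0.
set e := eps (par y) (word_par w).
have -> : lext (br_last y) (delta (x :: w)) =
    eps (par x) (word_par w) *: (mon w * gen (br (b x) (b y))) +
    gen (b x) * lext (br_last y) (delta w).
  rewrite linearD linearZ /= lextU; congr (_ + _).
  rewrite lext_comp [lext _ (delta w)]/lext mulr_sumr; apply: eq_bigr => q _ /=.
  by rewrite lextU /br_last mon_cons -mulrA scalerAr.
have -> : mon (x :: w) * gen (b y) - eps (par y) (word_par (x :: w)) *: (gen (b y) *
  mon (x :: w)) =
    gen (b x) * (mon w * gen (b y) - e *: (gen (b y) * mon w)) +
    e *: (gen (br (b x) (b y)) * mon w).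
  rewrite mon_cons [word_par _]/= epsDr -/e mulrBr -addrA !mulrA; congr (_ + _).
  rewrite -scalerAr mulrA (gen_swap x y) mulrDl scalerDr opprD -addrA addNr addr0.
  by rewrite -scalerAl scalerA mulrC (epsC (par y)).
rewrite opprD [X in low _ (_ + X)]addrC addrACA -mulrBr.
apply: lowD; first exact: low_genM.
have := @gen_mon_swap _ _ w (@br_parity x y); rewrite epsD -/e => /(@lowZ _ e _).
by rewrite scalerBr scalerA mulrCA eps_sqr mulr1.
Qed.

Local Notation D := {malg K[(seq X * X)%type]}.

Lemma mcoeff_delta_cons x (v : D) N m :
  (lext (fun q => << (x :: q.1, q.2) >> : D) v)@_(x :: N, m) = v@_(N, m).
Proof.
rewrite -[in RHS](lext_unit v) /lext !raddf_sum; apply: eq_bigr => -[N' m'] _ /=.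
by rewrite !mcoeffZ !mcoeffU !xpair_eqE eqseq_cons eqxx.
Qed.

Lemma delta_supp w q : q \in msupp (delta w) -> perm_eq w (q.2 :: q.1).
Proof.
elim: w q => [|x w IH] q /=; first by rewrite msupp0.
case/msuppDP => [/mem_msuppZ|/msupp_lext[[N m] /IH /= pw]].
  by rewrite mem_msuppU => /eqP ->.
rewrite mem_msuppU => /eqP -> /=; apply/permP => P.
by rewrite /= (permP pw) /= addnCA.
Qed.

Lemma delta_subseq w q : q \in msupp (delta w) -> subseq q.1 w.
Proof.
elim: w q => [|x w IH] q /=; first by rewrite msupp0.
case/msuppDP => [/mem_msuppZ|/msupp_lext[[N m] /IH /= sN]].
  by rewrite mem_msuppU => /eqP -> /=; exact: (subseq_cons w x).
by rewrite mem_msuppU => /eqP -> /=; rewrite eqxx.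
Qed.

(** Equal letters are adjacent in a sorted word, and [ok x x] holds only for an even letter. *)
Lemma normal_repeat x w : normal (x :: w) -> x \in w ->
  ~~ par x /\ w = x :: rem x w.
Proof.
case: w => // y w nxyw xw; have := nxyw; rewrite normal_cons => /andP[/allP axw nyw].
have := axw x xw; rewrite /ok eqxx => /andP[_ px]; split=> //.
suff -> : x = y by rewrite /= eqxx.
move: (xw); rewrite inE => /orP[/eqP //|xw'].
apply: le_anti; move: nyw; rewrite normal_cons => /andP[/allP/(_ x xw')/andP[-> _] _].
by have /andP[-> _] := axw y (mem_head _ _).
Qed.

(** The copies of [m] contribute without cancellation: an odd letter occurs once, and an even one is
    moved without a sign. *)
Lemma mcoeff_delta w m : normal w -> m \in w ->
  exists c, (delta w)@_(rem m w, m) = eps (par m) c * (count_mem m w)%:R.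
Proof.
elim: w => // x w IH nxw; have := nxw; rewrite normal_cons => /andP[_ nw].
rewrite inE /= mcoeffD mcoeffZ mcoeffU.
case: (eqVneq x m) => [e _|xm /= mw].
  subst m; rewrite !eqxx mulr1n mulr1; have [xw|xw] := boolP (x \in w).
    have [px e] := normal_repeat nxw xw; exists false.
    rewrite [X in (X, x)]e mcoeff_delta_cons; have [c ->] := IH nw xw.
    by rewrite (negPf px) !eps0l !mul1r natrD.
  exists (word_par w); rewrite (count_memPn xw) addn0 mulr1 mcoeff_outdom ?addr0 //.
  apply/negP => /msupp_lext[[N m] /delta_supp /= pw].
  rewrite mem_msuppU xpair_eqE => /andP[/eqP e _]; move: xw.
  by rewrite e mem_head.
rewrite xpair_eqE (negPf xm) andbF mulr0 add0r add0n mcoeff_delta_cons.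
exact: IH.
Qed.

Lemma normal_perm_eq w w' : normal w -> normal w' -> perm_eq w w' -> w = w'.
Proof.
move=> nw nw'; apply: (sorted_eq ok_trans) => // x y /andP[/andP[xy _] /andP[yx _]].
by apply: le_anti; rewrite xy.
Qed.

(** The identity for [a = false] and the parity automorphism for [a = true], defined on coordinates
    because [U] carries no grading here. *)
Definition twist a (p : U) : U := lext (fun w => eps a (word_par w) *: mon w) (symb p).

(* The central elements of U, in the super sense: z y = y z for even y and
   z y = y z' for odd y, where z' is the image of z under the parity
   automorphism. *)
Definition central z := forall y, z * gen (b y) = gen (b y) * twist (par y) z.

(* If y is fresh for the letters D, then [m, y] can be moved to the end of a normal
   word in D without further straightening. *)
Definition fresh (D : seq X) y := {in D &, forall m d,
  {in msupp (co (br (b m) (b y))), forall k, le d k && (d != k)}}.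

(** In the sum of [mon_gen_delta] over the monomials of [z], the first two terms cancel by
    centrality; the remaining one inherits the degree bound. *)
Lemma central_delta z n y : central z -> low n.+1 z ->
  low n (lext (br_last y) (lext delta (symb z))).
Proof.
move=> cz lz; rewrite lext_comp -[X in low _ X]opprK -scaleN1r; apply: lowZ.
have -> : - \sum_(w <- msupp (symb z)) (symb z)@_w *: lext (br_last y) (delta w) =
  lext (fun w => mon w * gen (b y) - eps (par y) (word_par w) *: (gen (b y) * mon w)
                - lext (br_last y) (delta w)) (symb z).
  rewrite -[LHS]add0r -[X in X + _ = _](subrr (z * gen (b y))) {2}cz.
  rewrite -{1}[z]symbK /lext mulr_suml /twist /lext mulr_sumr -!sumrB.
  apply: eq_bigr => w _.
  by rewrite !scalerBr -scalerAl -!scalerAr !scalerA.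
apply: low_lext => w /lz sw; apply: (@low_le (size w)) => //.
exact: mon_gen_delta.
Qed.

Lemma symb_mon_gen w g : {in msupp (co g), forall k, normal (rcons w k)} ->
  symb (mon w * gen g) = lext (fun k => << rcons w k >>) (co g).
Proof.
move=> nwk; rewrite gen_lext /lext mulr_sumr linear_sum big_seq [RHS]big_seq.
apply: eq_bigr => k kg; rewrite -scalerAr linearZ /=; congr (_ *: _).
by rewrite -symb_mon ?nwk // -cats1 mon_cat /mon big_seq1.
Qed.

Lemma mcoeff_lext_rcons (v : {malg K[X]}) w w' k :
  (lext (fun x => << rcons w x >> : V) v)@_(rcons w' k) = v@_k *+ (w == w').
Proof.
rewrite -[in RHS](lext_unit v) /lext !raddf_sum -sumrMnl; apply: eq_bigr => x _ /=.
rewrite !mcoeffZ !mcoeffU eqseq_rcons.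
by case: eqP => _; rewrite ?andbF ?mulr0n ?mulr0.
Qed.

Lemma normal_rcons w x : normal w -> all (ok^~ x) w -> normal (rcons w x).
Proof.
elim: w => // y w IH; rewrite normal_cons => /andP[ayw nw] /= /andP[yx awx].
by rewrite -/(rcons w x) -[path _ _ _]/(normal (y :: rcons w x)) normal_cons all_rcons
  yx ayw IH.
Qed.

Lemma br_lextl (Y : choiceType) (f : Y -> G) v z :
  br (lext f v) z = lext (fun k => br (f k) z) v.
Proof.
rewrite /lext; apply: (big_rec2 (fun g h => br g z = h)) => [|k g h _ <-].
  exact: br0l.
by rewrite brDl brZl.
Qed.

(** * Central elements are polynomials in the central letters *)

Hypothesis char0 : forall n, n.+1%:R != 0 :> K.
Variable J : {pred X}.
(** The property specific to current and loop algebras: commuting with the fresh letters already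
    forces centrality. It is established in [map_center_fresh]. *)
Hypothesis J_fresh : forall (D : seq X) (a : {malg K[X]}), {subset msupp a <= D} ->
  (forall y, fresh D y -> br (lext b a) (b y) = 0) -> {subset msupp a <= J}.
Hypothesis J_even : {in J, forall m, ~~ par m}.
Hypothesis J_center : {in J, forall m y, br (b m) (b y) = 0}.

Lemma central_top z n w : central z -> low n.+1 z ->
  w \in msupp (symb z) -> size w = n -> {subset w <= J}.
Proof.
move=> cz lz wz sw m mw.
set v := symb z in wz *; set Dl := lext delta v.
pose N := rem m w; pose L := flatten (msupp v).
have nw : normal w by apply: (symb_normal wz).
have inD u : u \in msupp v -> {subset u <= L}.
  by move=> uv x xu; apply/flattenP; exists u.
(* [a] gathers the letters whose removal from a monomial of [z] leaves exactly [N], with their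
   weights. *)
pose a := lext (fun q => if q.1 == N then << q.2 >> else 0 : {malg K[X]}) Dl.
have aE k : a@_k = Dl@_(N, k).
  rewrite -[in RHS](lext_unit Dl) /a /lext !raddf_sum; apply: eq_bigr => -[N' k'] _ /=.
  rewrite !mcoeffZ !mcoeffU xpair_eqE; case: eqP => _; last by rewrite mcoeff0.
  by rewrite mcoeffU.
have DlD q : q \in msupp Dl -> [/\ q.2 \in L, normal q.1 & {subset q.1 <= L}].
  case/msupp_lext => u uv qu.
  have pu := delta_supp qu; have nu : normal u := symb_normal uv.
  split; first by apply: (inD u uv); rewrite (perm_mem pu) mem_head.
    have ss := delta_subseq qu.
    exact: (subseq_sorted ok_trans ss nu).
  by move=> x xq; apply: (inD u uv); rewrite (perm_mem pu) inE xq orbT.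
have sN : (size N).+1 = n.
  by rewrite /N size_rem // prednK //; case: (w) mw.
apply: (@J_fresh L a) => [k|y fy|].
- rewrite -mcoeff_neq0 aE mcoeff_neq0 => /DlD[].
  by [].
- suff a0 k : (co (br (lext b a) (b y)))@_k = 0.
    rewrite -[LHS]coK (_ : co _ = 0) ?linear0 //; apply/malgP => k.
    by rewrite a0 mcoeff0.
  (* [rcons N k] has length [n], one too many for a word in an element satisfying [low n], so its
     coefficient vanishes. *)
  have := @central_delta z n y cz lz (rcons N k).
  rewrite size_rcons sN ltnn.
  set Z := symb _; case: (boolP (rcons N k \in msupp Z)) => [_ /(_ isT) //|kZ _].
  rewrite -[RHS](mcoeff_outdom kZ) /Z [in RHS]lext_comp [in RHS]raddf_sum /=.
  have -> : lext b a = lext (fun q => lext b (if q.1 == N then << q.2 >> else 0)) Dl.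
    exact: lext_comp.
  rewrite br_lextl lext_comp raddf_sum /= big_seq [RHS]big_seq.
  apply: eq_bigr => -[N' k'] /DlD[/= kL nN' sN'].
  (* Since [y] is fresh, the letters of the bracket lie strictly above those of [N'], so the product
     is already a combination of sorted monomials. *)
  rewrite !mcoeffZ /br_last /= symb_mon_gen => [|u uk]; last first.
    apply: normal_rcons => //; apply/allP => d /sN' dL.
    by have /andP[du duN] := fy _ _ kL dL _ uk; rewrite /ok du duN.
  congr (_ * _); rewrite mcoeff_lext_rcons.
  case: eqP => _; last by rewrite linear0 br0l linear0 mcoeff0.
  by rewrite lextU.
(* It remains to see that [m] occurs in [a]. Only [w] contributes to the pair (N, m), since a normal
   word is determined by its letters, and the multiplicity of [m] is nonzero in characteristic 0. *)
have [c cE] := mcoeff_delta nw mw.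
rewrite -mcoeff_neq0 aE /Dl /lext raddf_sum /= (big_fsetD1 w) //= big1_fset.
  rewrite addr0 mcoeffZ cE mulf_neq0 // ?mcoeff_neq0 // mulf_neq0 //.
    by rewrite /eps expf_neq0 // oppr_eq0 oner_eq0.
  by move: mw; rewrite -has_pred1 has_count; case: (count _ _).
move=> u; rewrite !inE => /andP[uw uv] _; rewrite mcoeffZ.
rewrite (mcoeff_outdom (_ : (N, m) \notin _)) ?mulr0 //;
  apply/negP => /delta_supp /= pu.
move/eqP: uw; apply; apply: normal_perm_eq => //; first exact: (symb_normal uv).
by apply: perm_trans pu _; rewrite perm_sym perm_to_rem.
Qed.

Lemma mem_center_mul m y : m \in J -> gen (b m) * gen (b y) = gen (b y) * gen (b m).
Proof.
move=> mJ; rewrite gen_swap J_center // linear0 addr0.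
by rewrite (negPf (J_even mJ)) eps0l scale1r.
Qed.

Lemma mon_center_mul w y : {subset w <= J} ->
  mon w * gen (b y) = gen (b y) * mon w.
Proof.
elim: w => [|m w IH] wJ; first by rewrite /mon big_nil mul1r mulr1.
rewrite mon_cons -mulrA IH => [|x xw]; last by apply: wJ; rewrite inE xw orbT.
by rewrite mulrA mem_center_mul ?mulrA // wJ ?mem_head.
Qed.

Lemma word_par_center w : {subset w <= J} -> word_par w = false.
Proof.
elim: w => //= m w IH wJ; rewrite IH => [|x xw]; last by apply: wJ; rewrite inE xw orbT.
by rewrite (negPf (J_even _)) // wJ ?mem_head.
Qed.

Lemma central_mon w : normal w -> {subset w <= J} -> central (mon w).
Proof.
move=> nw wJ y; rewrite mon_center_mul // /twist symb_mon // lextU.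
by rewrite word_par_center // epsC eps0l scale1r.
Qed.

Lemma twist_linear a : linear (twist a).
Proof. by move=> c p q; rewrite /twist !linearP. Qed.

Lemma central_lin c p q : central p -> central q -> central (c *: p + q).
Proof.
by move=> cp cq y; rewrite twist_linear mulrDl mulrDr cq -scalerAl cp scalerAr.
Qed.

Lemma central0 : central 0.
Proof. by move=> y; rewrite /twist !linear0 mul0r mulr0. Qed.

Lemma central_lext (Y : choiceType) (f : Y -> U) v :
  {in msupp v, forall y, central (f y)} -> central (lext f v).
Proof.
move=> cf; rewrite /lext big_seq.
by elim/big_rec: _ => [|y p yv cp]; [exact: central0|apply: central_lin;
  first exact: cf].
Qed.

(** Induction on the degree: the top part lies in [S] by [central_top] and is itself central, so the
    rest is central of lower degree. An arbitrary [S] matches the definition of [subalg_gen]. *)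
Theorem central_subalg z (S : {pred U}) : GRing.subalg_closed S ->
  {in J, forall m, gen (b m) \in S} -> central z -> z \in S.
Proof.
move=> [S1 SL SM] SJ cz.
have S0 : 0 \in S by rewrite -[0](addNr 1) -scaleN1r SL.
have SZ c p : p \in S -> c *: p \in S by move=> pS; rewrite -[_ *: _]addr0 SL.
have Smon w : {subset w <= J} -> mon w \in S.
  elim: w => [|m w IH] wJ; first by rewrite /mon big_nil.
  rewrite mon_cons SM ?SJ ?wJ ?mem_head // IH // => x xw.
  by rewrite wJ // inE xw orbT.
have [n lz] : exists n, low n z.
  exists (\max_(w <- msupp (symb z)) size w).+1 => w wz; rewrite ltnS.
  by apply: (@leq_bigmax_seq _ _ xpredT (fun w => size w)).
elim: n z cz lz => [|n IH] z cz lz.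
  rewrite -[z]symbK (_ : symb z = 0) ?linear0 //; apply/malgP => w.
  by rewrite mcoeff0 mcoeff_outdom //; apply/negP => /lz.
pose top w := if size w == n then mon w else 0.
pose rest w := if size w == n then 0 else mon w.
have zE : z = lext top (symb z) + lext rest (symb z).
  rewrite -{1}[z]symbK -lext_addf; apply: eq_lext => w _.
  by rewrite /top /rest; case: eqP; rewrite ?addr0 ?add0r.
have topJ w : w \in msupp (symb z) -> size w == n -> {subset w <= J}.
  by move=> wz /eqP; apply: central_top lz wz.
have topS : lext top (symb z) \in S.
  rewrite /lext big_seq; elim/big_rec: _ => // w p wz pS; rewrite SL // /top.
  by case: ifP => // sw; apply: Smon; apply: topJ sw.
have ctop : central (lext top (symb z)).
  apply: central_lext => w wz; rewrite /top; case: ifP => sw; last exact: central0.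
  by apply: central_mon; [apply: symb_normal wz|apply: topJ sw].
rewrite zE -[lext top _]scale1r SL // IH //.
  have -> : lext rest (symb z) = -1 *: lext top (symb z) + z.
    by rewrite {3}zE scaleN1r addKr.
  exact: central_lin.
apply: low_lext => w wz; rewrite /rest; case: eqP => [_|/eqP sw]; first exact: low0.
apply: (@low_le (size w).+1); last exact: low_mon.
by rewrite ltn_neqAle sw -ltnS lz.
Qed.

Lemma twistE a (s : U -> U) : linear s ->
  (forall w, s (mon w) = eps a (word_par w) *: mon w) -> s =1 twist a.
Proof.
move=> s_lin s_mon p; rewrite -{1}[p]symbK.
pose s' : {linear U -> U} := HB.pack s (GRing.isLinear.Build K U U *:%R s s_lin).
apply: (etrans (lext_comp s' _ _)); apply: eq_bigr => w _ /=.
by rewrite s_mon.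
Qed.

Lemma mon_rem m w : {subset w <= J} -> m \in w -> mon w = gen (b m) * mon (rem m w).
Proof.
elim: w => // x w IH wJ; rewrite mon_cons /=; case: (eqVneq x m) => [-> //|xm].
rewrite inE eq_sym (negPf xm) /= => mw; rewrite mon_cons IH // => [|u uw]; last first.
  by apply: wJ; rewrite inE uw orbT.
by rewrite !mulrA mem_center_mul // wJ ?mem_head.
Qed.

Lemma mon_perm w w' : {subset w <= J} -> perm_eq w w' -> mon w = mon w'.
Proof.
elim: w w' => [|m w IH] w' wJ pw.
  by move: pw; rewrite perm_sym => /perm_nilP ->.
have mw' : m \in w' by rewrite -(perm_mem pw) mem_head.
rewrite (@mon_rem m w') // => [|x]; last by rewrite -(perm_mem pw); apply: wJ.
rewrite mon_cons (IH (rem m w')) // => [x xw|]; first by apply: wJ; rewrite inE xw orbT.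
by rewrite -(perm_cons m) (perm_trans pw) // perm_to_rem.
Qed.

(** Distinct exponent vectors give distinct sorted words, so the monomials of the polynomial go to
    distinct elements of the basis of [U]. *)
Theorem center_alg_indep (Y : Type) (v : Y -> X) : injective v ->
  (forall y, v y \in J) -> alg_indep (fun y => gen (b (v y))).
Proof.
move=> v_inj vJ n t t_inj p.
pose word (m : mpoly.multinom n) := sort le (flatten [seq nseq (mpoly.fun_of_multinom
  m i) (v (t i)) | i <- index_enum 'I_n]).
have wordJ m : {subset word m <= J}.
  by move=> x; rewrite mem_sort => /flattenP[s /mapP[i _ ->]] /nseqP[-> _].
(* Repeated letters are harmless, the letters of [J] being even. *)
have word_normal m : normal (word m).
  have := sort_sorted le_total (flatten [seq nseq (mpoly.fun_of_multinom m i) (v (t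
    i)) | i <- index_enum 'I_n]).
  rewrite -/(word m); elim: (word m) (@wordJ m) => // x w IH wJ.
  rewrite [sorted _ _]/= (path_sortedE le_trans) => /andP[xw /IH {}IH].
  rewrite normal_cons IH => [|z zw]; last by apply: wJ; rewrite inE zw orbT.
  rewrite andbT; apply/allP => z /(allP xw) xz; rewrite /ok xz.
  by rewrite (negPf (J_even _)) ?orbT // wJ ?mem_head.
have word_mon m : mon (word m) = \prod_(i < n) gen (b (v (t i))) ^+
  mpoly.fun_of_multinom m i.
  rewrite /word -(@mon_perm (flatten [seq nseq (mpoly.fun_of_multinom m i) (v (t i)) |
    i <- index_enum 'I_n])); last first.
  - by rewrite perm_sym perm_sort.
  - by move=> x; rewrite -(mem_sort le); apply: wordJ.
  rewrite /mon big_flatten big_map; apply: eq_bigr => i _.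
  by rewrite big_nseq iter_mulr_1.
have word_inj : injective word.
  move=> m m' e; apply/mpoly.mnmP => i.
  have C k : count_mem (v (t i)) (word k) = mpoly.fun_of_multinom k i.
    rewrite count_sort count_flatten -map_comp sumnE big_map.
    rewrite (bigD1 i) //= count_nseq /= eqxx mul1n big1 ?addn0 // => j ji.
    rewrite count_nseq /=; case: eqP => // /v_inj/t_inj e'.
    by rewrite e' eqxx in ji.
  by rewrite -!C e.
rewrite /mpoly.mmap => /(congr1 symb); rewrite linear0 linear_sum => p0.
apply/mpoly.mpolyP => m; rewrite mpoly.mcoeff0.
have := congr1 (mcoeff (word m)) p0; rewrite mcoeff0 raddf_sum /=.
have E m' : symb ((mpoly.mcoeff m' p)%:A * mpoly.mmap1 (fun i => gen (b (v (t i))))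
  m') =
    mpoly.mcoeff m' p *: << word m' >>.
  by rewrite /mpoly.mmap1 -word_mon -scalerAl mul1r linearZ /= symb_mon.
under eq_bigr => m' _ do rewrite E mcoeffZ mcoeffU (inj_eq word_inj).
case: (boolP (m \in mpoly.msupp p)) => [mp|mp _]; last exact: mpoly.memN_msupp_eq0.
rewrite (bigD1_seq m) ?mpoly.msupp_uniq //= eqxx mulr1 big1 ?addr0 // => m' /negPf ->.
by rewrite mulr0.
Qed.

End PBW.

(** * Current and loop algebras *)

(** Coordinates exist by spanning and are picked by choice; freeness makes them unique, hence linear
    in the vector. *)
Lemma family_basis_coord (K : fieldType) (L : lmodType K) (I : choiceType) (e : I ->
  L) :
  family_basis setT predT e -> exists co : L -> {malg K[I]},
    [/\ linear co, forall i, co (e i) = << i >> & forall u, lext e (co u) = u].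
Proof.
move=> [e_free e_gen].
have lext_inj (v : {malg K[I]}) : lext e v = 0 -> v = 0.
  move=> v0; apply/malgP => i; rewrite mcoeff0.
  have := e_free (msupp v) (fun i => v@_i) (fset_uniq _) (fun _ _ => isT) v0.
  by case: (msuppP v i) => // iv /(_ i iv).
have /choice[co coK] : forall u, exists v, lext e v = u.
  move=> u; have [s [c [_ ->]]] := (e_gen u).1 Logic.I.
  exists (\sum_(i <- s) c i *: << i >>); rewrite linear_sum.
  by apply: eq_bigr => i _; rewrite linearZ /= lextU.
have co_eq u v : lext e v = u -> co u = v.
  move=> vu; apply/eqP; rewrite -subr_eq0; apply/eqP/lext_inj.
  by rewrite linearB /= coK vu subrr.
exists co; split=> // [c u v|i]; last by apply: co_eq; rewrite lextU.
by apply: co_eq; rewrite linearP /= !coK.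
Qed.

Lemma br_center_tens (K : fieldType) (l : bracketAlgType K) (E : nmodType) (u : l)
    (r : E) (f : mapalg l E) : lie_center l u -> br (tens u r) f = 0.
Proof.
move=> uC; elim/mapalg_ind: f => [|f g If Ig|v s]; first exact: br0r.
  by rewrite brDr If Ig addr0.
by rewrite map_brU uC tens0.
Qed.

Lemma family_basis_mem (K : fieldType) (L : lmodType K) (I : choiceType) (V : set L)
    (J : {pred I}) (e : I -> L) j : family_basis V J e -> j \in J -> V (e j).
Proof.
move=> [_ VE] jJ; apply/VE; exists [:: j], (fun=> 1); rewrite big_seq1 scale1r.
by split=> // i; rewrite inE => /eqP ->.
Qed.

Section MapCenter.
Variables (K : fieldType) (char0 : forall n, n.+1%:R != 0 :> K).
Variables (l : bracketAlgType K) (I : choiceType) (e : I -> l) (co : l -> {malg K[I]}).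
Hypothesis co_linear : linear co.
Hypothesis co_e : forall i, co (e i) = << i >>.
Hypothesis coK : forall u, lext e (co u) = u.
Variable par : I -> bool.
Hypothesis br_parity : forall i j, coord_homog par co (par i (+) par j) (br (e i) (e
  j)).
Hypothesis br_anti : forall i j,
  br (e i) (e j) = - (eps K (par i) (par j) *: br (e j) (e i)).
Hypothesis br_jacobi : forall i j k,
  br (e i) (br (e j) (e k)) =
  br (br (e i) (e j)) (e k) + eps K (par i) (par j) *: br (e j) (br (e i) (e k)).
Variable J : {pred I}.
Hypothesis J_basis : family_basis (lie_center l) J e.
Hypothesis J_even : {in J, forall i, ~~ par i}.
Variables (leI : rel I) (E : nmodType) (leE : rel E).
Hypotheses (leI_total : total leI) (leI_anti : antisymmetric leI)
  (leI_trans : transitive leI).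
Hypotheses (leE_total : total leE) (leE_anti : antisymmetric leE)
  (leE_trans : transitive leE).
Hypothesis E_addIr : forall t : E, injective (+%R^~ t).
(** Some translate of a finite set of exponents lies strictly above the whole set; this provides
    fresh letters. *)
Hypothesis E_large : forall s : seq E, exists t : E,
  {in s &, forall r r', leE r' (r + t) && (r' != r + t)}.

HB.instance Definition _ := GRing.isLinear.Build K l {malg K[I]} *:%R co co_linear.

Local Notation X := (I * E)%type.
Local Notation M := (mapalg l E).

Definition lex_exp : rel X := fun x y =>
  if x.2 == y.2 then leI x.1 y.1 else leE x.2 y.2.

Lemma lex_exp_total : total lex_exp.
Proof.
by move=> [i r] [j s]; rewrite /lex_exp /= eq_sym; case: eqP => _;
  [exact: leI_total|exact: leE_total].
Qed.

Lemma lex_exp_anti : antisymmetric lex_exp.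
Proof.
move=> [i r] [j s]; rewrite /lex_exp /= [s == r]eq_sym;
  case: eqP => [-> /leI_anti -> //|rs].
by move/leE_anti.
Qed.

Lemma lex_exp_trans : transitive lex_exp.
Proof.
move=> [j s] [i r] [k t]; rewrite /lex_exp /=.
case: (r =P s) => [->|rs]; case: (s =P t) => [st|st] //; first exact: leI_trans.
  by subst t; move/eqP/negPf: rs => ->.
case: (r =P t) => [rt|_]; last exact: leE_trans.
by subst t => rs' sr; case: rs; apply: leE_anti; rewrite rs'.
Qed.

Definition basis_elt (x : X) : M := tens (e x.1) x.2.

Definition map_coord (f : M) : {malg K[X]} :=
  \sum_(r <- msupp (f : {malg l[E]}))
     lext (fun i => << (i, r) >>) (co (f : {malg l[E]})@_r).

Lemma mcoeff_lext_pair (v : {malg K[I]}) (r s : E) i :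
  (lext (fun j => << (j, s) >> : {malg K[X]}) v)@_(i, r) = v@_i *+ (s == r).
Proof.
rewrite -[in RHS](lext_unit v) /lext !raddf_sum -sumrMnl; apply: eq_bigr => j _ /=.
rewrite !mcoeffZ !mcoeffU xpair_eqE.
by case: (s == r); rewrite ?andbT ?andbF ?mulr0n ?mulr0 ?mulr1n.
Qed.

Lemma map_coordE f i r : (map_coord f)@_(i, r) = (co (f : {malg l[E]})@_r)@_i.
Proof.
rewrite [in RHS](monalgE f) !raddf_sum /=; apply: eq_bigr => s _.
by rewrite mcoeff_lext_pair mcoeffU !raddfMn.
Qed.

Lemma map_coord_linear : linear map_coord.
Proof.
move=> c f g; apply/malgP => -[i r].
by rewrite mcoeffD mcoeffZ !map_coordE mcoeffD mapalg_coefZ linearP mcoeffD mcoeffZ.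
Qed.

HB.instance Definition _ := GRing.isLinear.Build K M {malg K[X]} *:%R map_coord
  map_coord_linear.

Lemma map_coord_tens u r : map_coord (tens u r) = lext (fun i => << (i, r) >>) (co u).
Proof.
by apply/malgP => -[i s]; rewrite map_coordE mcoeffU mcoeff_lext_pair !raddfMn.
Qed.

Lemma map_coord_basis x : map_coord (basis_elt x) = << x >>.
Proof. by case: x => i r; rewrite map_coord_tens co_e lextU. Qed.

Lemma map_coordK f : lext basis_elt (map_coord f) = f.
Proof.
rewrite [RHS]monalgE /map_coord linear_sum; apply: eq_bigr => r _ /=.
rewrite lext_comp /=; under eq_bigr => i _ do rewrite lextU /basis_elt /= -tensZ.
by rewrite -[in RHS](coK _@_r) [in RHS]/lext raddf_sum.
Qed.

Lemma map_basis_parity x y : coord_homog (fun z => par z.1) map_coord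
  (par x.1 (+) par y.1) (br (basis_elt x) (basis_elt y)).
Proof.
move=> z; rewrite map_brU map_coord_tens => /msupp_lext[i /br_parity <-].
by rewrite mem_msuppU => /eqP ->.
Qed.

Lemma map_basis_anti x y : br (basis_elt x) (basis_elt y) =
  - (eps K (par x.1) (par y.1) *: br (basis_elt y) (basis_elt x)).
Proof. by rewrite !map_brU br_anti tensN tensZ addrC. Qed.

Lemma map_basis_jacobi x y z :
  br (basis_elt x) (br (basis_elt y) (basis_elt z)) =
  br (br (basis_elt x) (basis_elt y)) (basis_elt z)
  + eps K (par x.1) (par y.1) *: br (basis_elt y) (br (basis_elt x) (basis_elt z)).
Proof. by rewrite !map_brU br_jacobi tensD tensZ addrA [y.2 + _]addrCA addrA. Qed.

Definition center_index : pred X := fun x => x.1 \in J.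

Lemma center_coord u : lie_center l u -> {subset msupp (co u) <= J}.
Proof.
move=> /J_basis.2[s [c [sJ ->]]] i; rewrite linear_sum -mcoeff_neq0 raddf_sum /=.
apply: contraR => iJ; rewrite big_seq big1 // => j js.
rewrite linearZ mcoeffZ /= co_e mcoeffU; case: eqP => [ji|]; last by rewrite mulr0.
by rewrite -ji sJ in iJ.
Qed.

Lemma map_center_even : {in center_index, forall x, ~~ par x.1}.
Proof. by move=> x; apply: J_even. Qed.

Lemma map_center_br (x : X) f : x \in center_index -> br (basis_elt x) f = 0.
Proof.
by move=> xJ; apply/br_center_tens/(family_basis_mem J_basis).
Qed.

(** Translation by [t] is injective, so the contributions of different exponents of [f] do not
    mix. *)
Lemma coef_br_tens (f : M) u r t :
  (br f (tens u t) : {malg l[E]})@_(r + t) = br (f : {malg l[E]})@_r u.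
Proof.
elim/mapalg_ind: f => [|f g If Ig|v s].
- by rewrite br0l !mcoeff0 br0l.
- by rewrite brDl !mcoeffD If Ig brDl.
rewrite map_brU !mcoeffU (inj_eq (@E_addIr t)).
by case: eqP; rewrite ?mulr1n ?mulr0n ?br0l.
Qed.

(** For [t] large every [(i, t)] is fresh for [D]. Comparing coefficients by [coef_br_tens], each
    coefficient of the element commutes with all [e i], hence lies in the center of [l]. *)
Lemma map_center_fresh (D : seq X) (a : {malg K[X]}) : {subset msupp a <= D} ->
  (forall y, fresh lex_exp basis_elt map_coord D y -> br (lext basis_elt a) (basis_elt
    y) = 0) ->
  {subset msupp a <= center_index}.
Proof.
move=> aD aC; have [t tD] := E_large (unzip2 D).
set f := lext basis_elt a in aC.
have f0 i : br f (tens (e i) t) = 0.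
  apply: (aC (i, t)) => m d mD dD k.
  rewrite map_brU map_coord_tens => /msupp_lext[j _]; rewrite mem_msuppU => /eqP ->.
  have /andP[ld nd] := tD _ _ (map_f snd mD) (map_f snd dD).
  by rewrite /lex_exp /= (negPf nd) ld; case: (d) nd => d1 d2 /=;
    rewrite xpair_eqE negb_and orbC => ->.
have fE i r : a@_(i, r) = (co (f : {malg l[E]})@_r)@_i.
  rewrite -map_coordE /f (lext_comp map_coord) -[in LHS](lext_unit a).
  by congr mcoeff; apply: eq_bigr => x _; rewrite /= map_coord_basis.
move=> [i r]; rewrite -mcoeff_neq0 fE mcoeff_neq0; apply: center_coord => y.
rewrite -[y]coK /lext; elim/big_rec: _ => [|j z _ IH]; first exact: br0r.
by rewrite brDr IH addr0 brZr -(coef_br_tens f (e j) r t) f0 mcoeff0 scaler0.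
Qed.

Section Presentation.
Variable rel : M -> M -> K -> M -> Prop.
Hypothesis rel_homog : forall g h c k, rel g h c k -> exists a d,
  [/\ coord_homog (fun x => par x.1) map_coord a g,
      coord_homog (fun x => par x.1) map_coord d h, c = eps K a d & k = br g h].
Hypothesis rel_b : forall x y, rel (basis_elt x) (basis_elt y)
  (eps K (par x.1) (par y.1)) (br (basis_elt x) (basis_elt y)).
Local Notation U := (palg rel).
Local Notation gen := (fun jr : {j : I | j \in J} * E => pgen rel (tens (e (val jr.1))
  jr.2)).

(** [s] is the twist in terms intrinsic to each case: the identity for Lie algebras, a sign on the
    odd component for superalgebras. [twistE] identifies it with [twist]. *)
Theorem map_central_subalg (s : bool -> U -> U) z (S : {pred U}) :
  (forall a, linear (s a)) ->
  (forall a w, s a (mon basis_elt rel w) =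
               eps K a (word_par (fun x => par x.1) w) *: mon basis_elt rel w) ->
  (forall y, z * pgen rel (basis_elt y) = pgen rel (basis_elt y) * s (par y.1) z) ->
  GRing.subalg_closed S -> (forall jr, gen jr \in S) -> z \in S.
Proof.
move=> s_lin s_mon zc S_closed S_gen.
apply: (central_subalg (char0 1) (char0 2) lex_exp_total lex_exp_anti lex_exp_trans
  map_coord_linear map_coord_basis map_coordK map_basis_parity map_basis_anti
  map_basis_jacobi rel_homog rel_b char0 map_center_fresh map_center_even
  (fun x xJ y => map_center_br (basis_elt y) xJ) S_closed).
  by move=> [j r] jJ; apply: (S_gen (Sub j jJ, r)).
move=> y; rewrite zc; congr (_ * _).
exact: (twistE (char0 1) lex_exp_total lex_exp_anti lex_exp_trans
  map_coord_basis map_coordK rel_b).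
Qed.

Theorem map_center_alg_indep : alg_indep gen.
Proof.
apply: (center_alg_indep (char0 1) (char0 2) lex_exp_total lex_exp_anti lex_exp_trans
  map_coord_linear map_coord_basis map_coordK map_basis_parity map_basis_anti
  map_basis_jacobi rel_homog rel_b map_center_even
  (fun x xJ y => map_center_br (basis_elt y) xJ)
  (v := fun jr => (val jr.1, jr.2))).
  by move=> [j r] [j' r'] /= [/val_inj -> ->].
by move=> [j r]; apply: (valP j).
Qed.

End Presentation.
End MapCenter.

(** * Total orders on basis indices and exponents *)

Lemma exists_total_order (T : choiceType) :
  exists le : rel T, [/\ total le, antisymmetric le & transitive le].
Proof.
have [R Rwo] := well_ordering_principle T.
have Rch : wo_chain R (mem predT) by apply: (withinW Rwo).
have R_total : total R by move=> x y; apply: (wo_chainW Rch).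
have R_anti : antisymmetric R by move=> x y; apply: (wo_chain_antisymmetric Rch).
exists R; split=> // y x z xy yz.
have [//|zx] := orP (R_total x z).
(* Transitivity comes from a least element of {x, y, z}: either it is x, or antisymmetry identifies
   two of the three. *)
have [|m [[mA mP] _]] := Rwo [in [:: x; y; z]]; first by exists x; rewrite !inE eqxx.
move: mA mP; rewrite !inE => /or3P[]/eqP -> mP.
- by apply: mP; rewrite !inE eqxx !orbT.
- suff -> : x = y by [].
  by apply: R_anti; rewrite xy mP // !inE eqxx.
- suff -> : z = y by [].
  by apply: R_anti; rewrite yz mP // !inE eqxx orbT.
Qed.

Lemma exponents_order (k : map_kind) : exists le : rel (exponents k),
  [/\ total le, antisymmetric le, transitive le,
      forall t : exponents k, injective (+%R^~ t)
    & forall s : seq (exponents k), exists t : exponents k,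
        {in s &, forall r r', le r' (r + t) && (r' != r + t)}].
Proof.
case: k => /=.
  exists leq; split; [exact: leq_total|exact: anti_leq|exact: leq_trans|exact: addIn|].
  move=> s; exists (\max_(r <- s) r).+1 => r r' _ r's.
  have : (r' <= \max_(r <- s) r)%N by apply: leq_bigmax_seq.
  change ((r' <= \max_(r0 <- s) r0)%N -> (r' <= r + (\max_(r0 <- s) r0).+1)%N &&
    (r' != r + (\max_(r0 <- s) r0).+1)%N).
  by lia.
exists (fun x y : int => (x <= y)%R); split.
- exact: Order.TotalTheory.le_total.
- exact: Order.POrderTheory.le_anti.
- exact: Order.POrderTheory.le_trans.
- by move=> t; apply: addIr.
(* All exponents lie between -B and B, so adding 2B + 1 brings each of them above B. *)
move=> s; pose B := (\max_(r <- s) `|r|)%N; exists (B + B).+1%:Z => r r' rs r's.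
have rB : (`|r| <= B)%N by apply: (@leq_bigmax_seq _ _ xpredT (fun r : int => `|r|%N)).
have rB' : (`|r'| <= B)%N by apply: (@leq_bigmax_seq _ _ xpredT (fun r : int =>
  `|r|%N)).
by lia.
Qed.

Lemma palg_comm_gen (K : fieldType) (G : lmodType K) (rel : G -> G -> K -> G -> Prop)
    (p : palg rel) :
  (forall x, p * pgen rel x = pgen rel x * p) -> forall u, p * u = u * p.
Proof.
move=> pC u; rewrite -[u]prepK.
elim: (prep u) => [c|x|t It s Is|t It s Is].
- by rewrite ppiC -scalerAr mulr1 -scalerAl mul1r.
- exact: pC.
- by rewrite ppiD mulrDr mulrDl It Is.
- by rewrite ppiM mulrA It -!mulrA Is.
Qed.

Definition centralizing (K : fieldType) (A : algType K) : {pred A} :=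
  fun z => `[< forall u, z * u = u * z >].

Lemma centralizingP (K : fieldType) (A : algType K) (z : A) :
  reflect (forall u, z * u = u * z) (z \in @centralizing K A).
Proof. exact: asboolP. Qed.

Lemma centralizing_closed (K : fieldType) (A : algType K) :
  GRing.subalg_closed (@centralizing K A).
Proof.
split=> [|c p q /centralizingP pC /centralizingP qC|p q /centralizingP pC
  /centralizingP qC];
  apply/centralizingP => u.
- by rewrite mul1r mulr1.
- by rewrite mulrDl mulrDr -scalerAl -scalerAr pC qC.
- by rewrite -mulrA qC mulrA pC -mulrA.
Qed.

(** * The theorem for Lie algebras *)

Section LieCase.
Variables (K : fieldType) (char0 : forall n, n.+1%:R != 0 :> K) (k : map_kind).
Variables (l : lieAlgType K) (I : choiceType) (J : {pred I}) (e : I -> l).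
Hypotheses (e_basis : family_basis setT predT e)
  (J_basis : family_basis (lie_center l) J e).
Local Notation M := (mapalg l (exponents k)).
Local Notation gen := (fun jr : {j : I | j \in J} * exponents k =>
  ulie_gen (tens (e (val jr.1)) jr.2 : M)).

Lemma lie_brC (x y : l) : br x y = - br y x.
Proof.
have := lie_alt (x + y); rewrite brDl !brDr !lie_alt add0r addr0.
by move/eqP; rewrite addr_eq0 => /eqP.
Qed.

Lemma ulie_gen_comm jr u : gen jr * u = u * gen jr.
Proof.
apply: palg_comm_gen => x;
  rewrite (@pgen_rel _ _ _ _ _ 1 (br (tens (e (val jr.1)) jr.2 : M) x)) //.
rewrite br_center_tens; last exact: (family_basis_mem J_basis (valP jr.1)).
have := pgen_linear (@lie_rel K M) (-1) 0 0.
by rewrite scaler0 addr0 scaleN1r addNr => ->; rewrite scale1r addr0.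
Qed.

Theorem ulie_center_map :
  let Z := assoc_center (ulie M) in
  Z = subalg_gen (range gen) /\ freely_generated Z gen.
Proof.
have [co [co_lin co_e coK]] := family_basis_coord e_basis.
have [leI [leI_total leI_anti leI_trans]] := exists_total_order I.
have [leE [leE_total leE_anti leE_trans E_addI E_large]] := exponents_order k.
pose par : I -> bool := fun=> false.
have homP i j : coord_homog par co (par i (+) par j) (br (e i) (e j)) by [].
have anti i j : br (e i) (e j) = - (eps K (par i) (par j) *: br (e j) (e i)).
  by rewrite eps0l scale1r lie_brC.
have jac i j h : br (e i) (br (e j) (e h)) =
    br (br (e i) (e j)) (e h) + eps K (par i) (par j) *: br (e j) (br (e i) (e h)).
  rewrite eps0l scale1r; have /eqP := lie_jacobi (e i) (e j) (e h).
  rewrite -addrA addr_eq0 => /eqP ->.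
  rewrite (lie_brC (br (e i) (e j))) (lie_brC (e i) (e h)).
  by rewrite -[- br (e h) (e i)]scaleN1r brZr scaleN1r opprD addrC.
have J_even : {in J, forall i, ~~ par i} by [].
have rel_hom (g h : M) c y : lie_rel g h c y -> exists a d,
    [/\ coord_homog (fun x => par x.1) (map_coord co (E := exponents k)) a g,
        coord_homog (fun x => par x.1) (map_coord co (E := exponents k)) d h,
        c = eps K a d & y = br g h].
  by move=> [-> ->]; exists false, false; rewrite eps0l.
have rel_b x y : lie_rel (basis_elt e x) (basis_elt e y)
    (eps K (par x.1) (par y.1)) (br (basis_elt e x) (basis_elt e y) : M).
  by split; rewrite ?eps0l.
move=> Z.
have ZP z : Z z <-> z \in @centralizing K (ulie M).
  split=> [zZ|/centralizingP zC u]; last by rewrite zC subrr.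
  by apply/centralizingP => u; apply/eqP; rewrite -subr_eq0; apply/eqP/zZ.
(* One inclusion is [map_central_subalg]; the other holds because the centralizing elements form a
   subalgebra containing the generators. *)
have ZE : Z = subalg_gen (range gen).
  apply/seteqP; split=> z.
  move=> /ZP/centralizingP zC S S_closed S_gen.
  apply: (map_central_subalg char0 co_lin co_e coK homP anti jac J_basis J_even
    leI_total leI_anti leI_trans leE_total leE_anti leE_trans E_addI E_large
    rel_hom rel_b (s := fun _ p => p)).
  - by [].
  - move=> a w; have -> : word_par (fun x : I * exponents k => par x.1) w = false by
      elim: w.
    rewrite epsC eps0l; exact: esym (scale1r _).
  - move=> y; exact: (zC (pgen (@lie_rel K M) (basis_elt e y))).
  - exact: S_closed.
  - by move=> jr; apply: S_gen; exists jr.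
  move/(_ _ (@centralizing_closed K (ulie M))) => zS; apply/ZP/zS => x [jr _ <-].
  exact/centralizingP/ulie_gen_comm.
split=> //; split=> //; first by move=> z w /ZP/centralizingP.
exact: (map_center_alg_indep char0 co_lin co_e coK homP anti jac J_basis J_even
  leI_total leI_anti leI_trans leE_total leE_anti leE_trans rel_hom rel_b).
Qed.

End LieCase.

(** * The theorem for Lie superalgebras *)

HB.instance Definition _ (K : fieldType) (V : superModType K) (a : bool) :=
  GRing.isLinear.Build K V V *:%R (@gcomp K V a) (gcomp_linear a).

Section GradedCoord.
Variables (K : fieldType) (V : lieSuperAlgType K) (I : choiceType) (e : I -> V).
Variables (co : V -> {malg K[I]}) (par : I -> bool).
Hypotheses (co_linear : linear co) (co_e : forall i, co (e i) = << i >>).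
Hypotheses (coK : forall u, lext e (co u) = u).
Hypothesis e_par : forall i, homogeneous (par i) (e i).
HB.instance Definition _ := GRing.isLinear.Build K V {malg K[I]} *:%R co co_linear.

(** Projecting the expansion of [u] to degree [a] leaves [u] unchanged and kills the basis vectors
    of the other parity. *)
Lemma homogeneous_coord a u : homogeneous a u -> coord_homog par co a u.
Proof.
move=> ua i; rewrite -mcoeff_neq0; apply: contraNeq => /negbTE pa.
rewrite -ua -[u]coK lext_comp linear_sum raddf_sum /= big1 // => j _.
rewrite linearZ mcoeffZ /= (homog_gcompE a (e_par j)) [a == _]eq_sym.
case: (eqVneq (par j) a) => [pj|_]; last by rewrite linear0 mcoeff0 mulr0.
rewrite co_e mcoeffU; case: eqP => [ji|_]; last by rewrite mulr0.
by rewrite -ji pj eqxx in pa.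
Qed.

End GradedCoord.

Section SuperCase.
Variables (K : fieldType) (char0 : forall n, n.+1%:R != 0 :> K) (k : map_kind).
Variables (l : lieSuperAlgType K) (I : choiceType) (J : {pred I}) (e : I -> l).
Hypothesis center_even : (lie_center l `<=` homogeneous false)%classic.
Hypothesis e_homog : forall i, exists a, homogeneous a (e i).
Hypotheses (e_basis : family_basis setT predT e)
  (J_basis : family_basis (lie_center l) J e).
Local Notation M := (mapalg l (exponents k)).
Local Notation U := (usuper M).
Local Notation gen := (fun jr : {j : I | j \in J} * exponents k =>
  usuper_gen (tens (e (val jr.1)) jr.2 : M)).

(** The relations only concern homogeneous elements, so the other generator is split into its two
    components; the sign is 1 because the center is even. *)
Lemma usuper_gen_comm jr u : gen jr * u = u * gen jr.
Proof.
have eC := family_basis_mem J_basis (valP jr.1).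
have g0 : pgen (@lieSuper_rel K M) 0 = 0.
  by have := pgen_linear (@lieSuper_rel K M) (-1) 0 0;
    rewrite scaler0 addr0 scaleN1r addNr.
apply: palg_comm_gen => x.
have H a : gen jr * usuper_gen (gcomp a x) = usuper_gen (gcomp a x) * gen jr.
  have r : lieSuper_rel (tens (e (val jr.1)) jr.2 : M) (gcomp a x) 1 (br (tens (e (val
    jr.1)) jr.2 : M) (gcomp a x)).
    by exists false, a; split=> //; [apply/homog_tens/center_even|exact: homog_gcomp].
  by rewrite (pgen_rel r) br_center_tens // g0 addr0 scale1r.
have xE : pgen (@lieSuper_rel K M) x = usuper_gen (gcomp false x) + usuper_gen (gcomp
  true x).
  have := pgen_linear (@lieSuper_rel K M) 1 (gcomp false x) (gcomp true x).
  by rewrite !scale1r gcomp_sum.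
by rewrite xE mulrDr mulrDl -!H.
Qed.

(** This brings the superbracket into the form used in [central], with the twist of [z] on the
    right. *)
Lemma superbr_homogr (A : superAlgType K) a (z u : A) : homogeneous a u ->
  superbr z u = z * u - u * (gcomp false z + eps K true a *: gcomp true z).
Proof.
move=> ua; have zE : z * u = gcomp false z * u + gcomp true z * u.
  by rewrite -mulrDl gcomp_sum.
rewrite zE mulrDr -scalerAr opprD [RHS]addrACA addrC /superbr !big_bool /=.
rewrite !(homog_gcompE _ ua) /eps.
by case: a {ua}; rewrite /= ?(mulr0, mul0r, scaler0, oppr0, subr0, add0r, addr0,
  expr0, scale1r).
Qed.

Lemma usuper_homog1 : homogeneous false (1 : U).
Proof.
have := ugcomp_pi false (AConst M 1); rewrite /= scale1r.
by rewrite ppiC scale1r.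
Qed.

(** Evenness turns the superbracket into the commutator; an odd element that commutes with
    everything need not be supercentral. *)
Definition even_centralizing : {pred U} :=
  fun z => `[< homogeneous false z /\ forall u, z * u = u * z >].

Lemma even_centralizing_closed : GRing.subalg_closed even_centralizing.
Proof.
split=> [|c p q /asboolP[p0 pC] /asboolP[q0 qC]|p q /asboolP[p0 pC] /asboolP[q0 qC]];
  apply/asboolP; split.
- exact: usuper_homog1.
- by move=> u; rewrite mul1r mulr1.
- by rewrite /homogeneous /= gcompD gcompZ p0 q0.
- by move=> u; rewrite mulrDl mulrDr -scalerAl -scalerAr pC qC.
- exact: (homogeneousM _ _ _ _ p0 q0).
- by move=> u; rewrite -mulrA qC mulrA pC -mulrA.
Qed.

Theorem usuper_center_map :
  let Z := super_center U in
  Z = subalg_gen (range gen) /\ freely_generated Z gen.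
Proof.
have [co [co_lin co_e coK]] := family_basis_coord e_basis.
have [leI [leI_total leI_anti leI_trans]] := exists_total_order I.
have [leE [leE_total leE_anti leE_trans E_addI E_large]] := exponents_order k.
have /choice[par e_par] := e_homog.
have coP := homogeneous_coord co_lin co_e coK e_par.
have homP i j : coord_homog par co (par i (+) par j) (br (e i) (e j)).
  exact/coP/br_homog.
have anti i j : br (e i) (e j) = - (eps K (par i) (par j) *: br (e j) (e i)).
  exact: br_superC.
have jac i j h : br (e i) (br (e j) (e h)) =
    br (br (e i) (e j)) (e h) + eps K (par i) (par j) *: br (e j) (br (e i) (e h)).
  exact: br_superJacobi.
(* [e i] is nonzero, its coordinate vector being a basis vector, so it cannot be both even and
   odd. *)
have J_even : {in J, forall i, ~~ par i}.
  move=> i iJ; have /center_even := family_basis_mem J_basis iJ.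
  have ei : co (e i) <> 0 by rewrite co_e => /eqP; rewrite monalgU_eq0 oner_eq0.
  move/(homog_gcompE true) => e0; apply/negP => pi; apply: ei.
  have := e_par i; rewrite pi /homogeneous /= e0 => <-.
  by have := co_lin (-1) 0 0; rewrite scaler0 addr0 scaleN1r addNr.
have map_coP a (f : M) : homogeneous a f ->
    coord_homog (fun x => par x.1) (map_coord co (E := exponents k)) a f.
  move=> fa [i r]; rewrite -mcoeff_neq0 map_coordE // mcoeff_neq0 => /coP; apply.
  exact: homog_coef.
have homb x : homogeneous (par x.1) (basis_elt e x : M) by apply: homog_tens.
have rel_hom (g h : M) c y : lieSuper_rel g h c y -> exists a d,
    [/\ coord_homog (fun x => par x.1) (map_coord co (E := exponents k)) a g,
        coord_homog (fun x => par x.1) (map_coord co (E := exponents k)) d h,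
        c = eps K a d & y = br g h].
  by move=> [a [d [ga hd -> ->]]]; exists a, d; split=> //; apply: map_coP.
have rel_b x y : lieSuper_rel (basis_elt e x) (basis_elt e y)
    (eps K (par x.1) (par y.1)) (br (basis_elt e x) (basis_elt e y) : M).
  by exists (par x.1), (par y.1); split=> //; apply: homb.
move=> Z.
have ZC z : z \in even_centralizing -> Z z.
  move=> /asboolP[z0 zC] u; rewrite /superbr !big_bool /= !(homog_gcompE _ z0) /=.
  by rewrite !(mul0r, mulr0, scaler0, oppr0, addr0, add0r, expr0, scale1r) !zC !subrr
    addr0.
have gen_even jr : gen jr \in even_centralizing.
  apply/asboolP; split; last exact: usuper_gen_comm.
  exact/usuper_homog_gen/homog_tens/center_even/(family_basis_mem J_basis (valP jr.1)).
have mon_homog w : homogeneous (word_par (fun x => par x.1) w)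
    (mon (basis_elt e (E := exponents k)) (@lieSuper_rel K M) w : U).
  elim: w => [|x w IH]; first by rewrite /mon big_nil; exact: usuper_homog1.
  by rewrite mon_cons; exact: (homogeneousM _ _ _ _ (usuper_homog_gen (homb x)) IH).
have ZE : Z = subalg_gen (range gen).
  apply/seteqP; split=> z; last first.
    move/(_ _ even_centralizing_closed) => zS; apply/ZC/zS => x [jr _ <-].
    exact: gen_even.
  move=> zZ S S_closed S_gen.
  apply: (map_central_subalg char0 co_lin co_e coK homP anti jac J_basis J_even
    leI_total leI_anti leI_trans leE_total leE_anti leE_trans E_addI E_large
    rel_hom rel_b (s := fun a p => gcomp false (p : U) + eps K true a *: gcomp true (p
      : U))).
  - move=> a c p q; rewrite !gcompD !gcompZ scalerDr scalerDr addrACA.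
    by rewrite !scalerA [_ * c]mulrC.
  - move=> a w; rewrite !(homog_gcompE _ (mon_homog w)).
    by case: (word_par _ w); case: a;
      rewrite /eps /= ?scaler0 ?add0r ?addr0 ?expr0 ?scale1r.
  - move=> y; have := zZ (pgen (@lieSuper_rel K M) (basis_elt e y)).
    rewrite (superbr_homogr _ (usuper_homog_gen (homb y))) => /eqP.
    by rewrite subr_eq0 => /eqP.
  - exact: S_closed.
  - by move=> jr; apply: S_gen; exists jr.
split=> //; split=> //.
  (* Commutativity in the ordinary sense is obtained from the generators: by [ZE] every element of
     [Z] is even and centralizing. *)
  move=> z w; rewrite ZE => /(_ _ even_centralizing_closed) zS _.
  suff /asboolP[_ zC] : z \in even_centralizing by exact: zC.
  by apply: zS => x [jr _ <-]; exact: gen_even.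
exact: (map_center_alg_indep char0 co_lin co_e coK homP anti jac J_basis J_even
  leI_total leI_anti leI_trans leE_total leE_anti leE_trans rel_hom rel_b).
Qed.

End SuperCase.

Theorem theorem1 (K : closedFieldType) (charK : [pchar K] =i pred0)
    (k : map_kind) :
  (forall (l : lieAlgType K) (I : choiceType) (J : {pred I}) (e : I -> l),
     family_basis setT predT e ->
     family_basis (lie_center l) J e ->
     let Z := assoc_center (ulie (mapalg l (exponents k))) in
     let gen (jr : {j : I | j \in J} * exponents k) :=
       ulie_gen (tens (e (val jr.1)) jr.2) in
     Z = subalg_gen (range gen) /\
     (lie_center l <> [set 0]%classic -> freely_generated Z gen))
  /\
  (forall (l : lieSuperAlgType K) (I : choiceType) (J : {pred I}) (e : I -> l),
     (lie_center l `<=` homogeneous false)%classic ->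
     (forall i, exists a, homogeneous a (e i)) ->
     family_basis setT predT e ->
     family_basis (lie_center l) J e ->
     let Z := super_center (usuper (mapalg l (exponents k))) in
     let gen (jr : {j : I | j \in J} * exponents k) :=
       usuper_gen (tens (e (val jr.1)) jr.2) in
     Z = subalg_gen (range gen) /\
     (lie_center l <> [set 0]%classic -> freely_generated Z gen)).
Proof.
have char0 n : n.+1%:R != 0 :> K by rewrite (pcharf0P K).1.
split=> l I J e.
  move=> e_basis J_basis.
  by have [ZE Zfree] := ulie_center_map char0 k e_basis J_basis; split.
move=> C_even e_homog e_basis J_basis.
by have [ZE Zfree] := usuper_center_map char0 k C_even e_homog e_basis J_basis; split.
Qed.
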